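(* Let $z_1<z_2$ be real numbers, $m'\ge 1$ an integer, and let $\theta_0,\theta_1,\dots,\theta_{m'}:[z_1,z_2]\to[z_1,z_2]$ be continuous functions with $z_1=\theta_0(v)<\theta_1(v)<\dots<\theta_{m'-1}(v)<\theta_{m'}(v)=v$ for $z_1<v\le z_2$ (all equal to $z_1$ at $v=z_1$). Let $K_1,\dots,K_{m'}:[z_1,z_2]\times[z_1,z_2]\to\mathbb{R}$, $(r,v)\mapsto K_t(r,v)$, be positive and continuous, and put $M_t=\max_{z_1\le r,v\le z_2}|K_t(r,v)|$. Let $Y:[z_1,z_2]\to\mathbb{R}_\digamma$ be a continuous fuzzy-number-valued function, and let $G:\mathbb{R}_\digamma\to\mathbb{R}_\digamma$ be continuous. Suppose there exists $L>0$ such that $$\mathcal{D}(G(Z_1(p)),G(Z_2(p_1)))\le L\,\mathcal{D}(Z_1(p),Z_2(p_1))\qquad\text{for all } p,p_1\in[z_1,z_2] \text{ and all } Z_1,Z_2\in X .$$ Let $$c=\sup_{z_1\le v\le z_2}\ \sum_{t=1}^{m'}M_tL\,(\theta_t(v)-\theta_{t-1}(v)),$$ and suppose $c<1$. Then the fuzzy Volterra integral equation $$Z(v)=Y(v)\oplus\sum_{t=1}^{m'}(\mathcal{FR})\int_{\theta_{t-1}(v)}^{\theta_t(v)}K_t(r,v)\odot G(Z(r))\,dr,\qquad z_1\le v\le z_2,$$ has a unique solution $F^*\in X$. Moreover, the successive approximations $$Z_0(v)=Y(v),\qquad Z_m(v)=Y(v)\oplus\sum_{t=1}^{m'}(\mathcal{FR})\int_{\theta_{t-1}(v)}^{\theta_t(v)}K_t(r,v)\odot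 G(Z_{m-1}(r))\,dr,\quad m\ge1,$$ converge to $F^*$, and $$\mathcal{D}(F^*(v),Z_m(v))\le\frac{c^{m+1}}{L(1-c)}\,M_0\qquad\text{for all } v\in[z_1,z_2],\ m\ge1,$$ where $M_0=\sup_{z_1\le v\le z_2}\|G(Y(v))\|_\digamma$.
   Context: A fuzzy number is a function $p:\mathbb{R}\to[0,1]$ that is normal ($p(x_0)=1$ for some $x_0$), fuzzy convex ($p(\gamma x+(1-\gamma)y)\ge\min\{p(x),p(y)\}$ for all $x,y\in\mathbb{R}$, $\gamma\in[0,1]$), upper semicontinuous, and such that the closure of $\{x:p(x)>0\}$ is compact. $\mathbb{R}_\digamma$ denotes the set of all fuzzy numbers. A fuzzy number is represented in parametric form $(\underline{p}(\mu),\overline{p}(\mu))$, $0\le\mu\le1$, the endpoints of its $\mu$-level set (with the closure of the support for $\mu=0$); $\underline{p}$ is bounded, left continuous, non-decreasing, $\overline{p}$ is bounded, left continuous, non-increasing, and $\underline p(\mu)\le\overline p(\mu)$. Operations: $(p\oplus p_1)(\mu)=(\underline p(\mu)+\underline{p_1}(\mu),\overline p(\mu)+\overline{p_1}(\mu))$; $(\gamma\odot p)(\mu)=(\gamma\underline p(\mu),\gamma\overline p(\mu))$ if $\gamma\ge0$ and $(\gamma\overline p(\mu),\gamma\underline p(\mu))$ if $\gamma<0$. Sums $\sum$ of fuzzy numbers are taken with respect to $\oplus$. $\tilde0$ is the fuzzy number equal to $1$ at $0$ and $0$ elsewhere. Distance: $\mathcal{D}(p,p_1)=\sup_{\mu\in[0,1]}\max\{|\underline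 p(\mu)-\underline{p_1}(\mu)|,|\overline p(\mu)-\overline{p_1}(\mu)|\}$; $(\mathbb{R}_\digamma,\mathcal{D})$ is a complete metric space. Continuity of maps into or out of $\mathbb{R}_\digamma$ is with respect to $\mathcal{D}$. Write $\|p\|_\digamma=\mathcal{D}(p,\tilde0)$. $X=\{Y:[z_1,z_2]\to\mathbb{R}_\digamma : Y \text{ continuous}\}$ with the metric $\mathcal{D}^*(Y,V)=\sup_{z_1\le v\le z_2}\mathcal{D}(Y(v),V(v))$; convergence of the successive approximations is in $\mathcal{D}^*$. Fuzzy Riemann integral: $Y:[a,b]\to\mathbb{R}_\digamma$ is fuzzy-Riemann integrable to $I\in\mathbb{R}_\digamma$, written $I=(\mathcal{FR})\int_a^bY(x)\,dx$, if for every $\varepsilon>0$ there is $\rho>0$ such that for every tagged partition of $[a,b]$ of norm less than $\rho$ the fuzzy Riemann sum (sum with respect to $\oplus$ of (length of subinterval) $\odot\,Y$(tag)) is within $\mathcal{D}$-distance $\varepsilon$ of $I$. For continuous $Y$ the integral exists, and its lower and upper parametric functions are the ordinary integrals of $\underline Y(x;\mu)$ and $\overline Y(x;\mu)$. *)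

(* Defs.v *)
From HB Require Import structures.
From mathcomp Require Import all_boot all_order all_algebra.
From mathcomp Require Import all_classical all_reals all_analysis.
From mathcomp Require Import lra.

Set Implicit Arguments.
Unset Strict Implicit.
Unset Printing Implicit Defensive.

Import Order.TTheory GRing.Theory Num.Theory.
Import numFieldNormedType.Exports.

Local Open Scope classical_set_scope.
Local Open Scope ring_scope.

Definition upper_semicontinuous (R : realType) (p : R -> R) :=
  forall x a, p x < a -> \forall y \near x, p y < a.

Record fuzzy_number (R : realType) := FuzzyNumber {
  membership :> R -> R ;
  membership_itv : forall x, 0 <= membership x <= 1 ;
  membership_normal : exists x, membership x = 1 ;
  membership_convex : forall x y g, 0 <= g <= 1 ->
    Num.min (membership x) (membership y) <= membership (g * x + (1 - g) * y) ;
  membership_usc : upper_semicontinuous membership ;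
  membership_compact : compact (closure [set x | 0 < membership x]) }.

Arguments membership_compact {R} f.
Arguments membership_usc {R} f.

Section parametric_form.
Context {R : realType}.
Implicit Types p q : fuzzy_number R.

Definition level p (mu : R) : set R :=
  if mu == 0 then closure [set x | 0 < p x] else [set x | mu <= p x].

Definition lower p (mu : R) : R := inf (level p mu).
Definition upper p (mu : R) : R := sup (level p mu).

Lemma fuzzy_ext p q : p =1 q -> p = q.
Proof.
case: p q => [p p1 p2 p3 p4 p5] [q q1 q2 q3 q4 q5] /= /funext pq.
by subst q; f_equal; exact: Prop_irrelevance.
Qed.

Lemma level_gt0 p mu : 0 < mu -> level p mu = [set x | mu <= p x].
Proof. by move=> mu0; rewrite /level gt_eqF. Qed.

Lemma level_sub0 p mu : 0 <= mu -> level p mu `<=` level p 0.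
Proof.
rewrite le_eqVlt => /predU1P[<-//|mu0]; rewrite level_gt0// /level eqxx => x /= h.
by apply: subset_closure => /=; exact: lt_le_trans h.
Qed.

Lemma level_neq0 p mu : 0 <= mu <= 1 -> level p mu !=set0.
Proof.
case/andP=> mu0 mu1; have [x px] := membership_normal p; exists x.
rewrite /level; case: ifP => _ /=; last by rewrite px.
by apply: subset_closure; rewrite /= px.
Qed.

Lemma level_bounded p : exists M, forall x, level p 0 x -> `|x| <= M.
Proof.
have [M [_ hM]] := compact_bounded (membership_compact p).
exists (M + 1) => x; rewrite /level eqxx => px.
by apply: (hM (M + 1)) => //; rewrite ltrDl.
Qed.

Lemma level_has_inf p mu : 0 <= mu <= 1 -> has_inf (level p mu).
Proof.
move=> h; split; first exact: level_neq0.
have [M hM] := level_bounded p; exists (- M) => x /level_sub0 px.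
by have := hM x (px (andP h).1); rewrite ler_norml => /andP[].
Qed.

Lemma level_has_sup p mu : 0 <= mu <= 1 -> has_sup (level p mu).
Proof.
move=> h; split; first exact: level_neq0.
have [M hM] := level_bounded p; exists M => x /level_sub0 px.
by have := hM x (px (andP h).1); rewrite ler_norml => /andP[].
Qed.

Lemma level_lower p mu : 0 < mu <= 1 -> mu <= p (lower p mu).
Proof.
case/andP=> mu0 mu1; rewrite leNgt; apply/negP => /(membership_usc p).
have hi : has_inf (level p mu) by apply: level_has_inf; rewrite (ltW mu0).
move=> /nbhs_ballP[e /= e0 he].
have [y py ye] := inf_adherent e0 hi.
have := he y; rewrite /ball /= distrC ger0_norm ?subr_ge0; last first.
  exact: (ge_inf hi.2).
rewrite ltrBlDl => /(_ ye); move: py; rewrite level_gt0// => /= py.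
by rewrite ltNge py.
Qed.

Lemma level_upper p mu : 0 < mu <= 1 -> mu <= p (upper p mu).
Proof.
case/andP=> mu0 mu1; rewrite leNgt; apply/negP => /(membership_usc p).
have hs : has_sup (level p mu) by apply: level_has_sup; rewrite (ltW mu0).
move=> /nbhs_ballP[e /= e0 he].
have [y py ye] := sup_adherent e0 hs.
have := he y; rewrite /ball /= ger0_norm ?subr_ge0; last first.
  exact: (ub_le_sup hs.2).
rewrite ltrBlDl -ltrBlDr => /(_ ye); move: py; rewrite level_gt0// => /= py.
by rewrite ltNge py.
Qed.

Lemma levelP p mu x : 0 < mu <= 1 ->
  (mu <= p x) = (lower p mu <= x <= upper p mu).
Proof.
move=> hmu; have /andP[mu0 mu1] := hmu.
have hmu' : 0 <= mu <= 1 by rewrite (ltW mu0).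
apply/idP/idP => [px|/andP[lx xu]].
  have px' : level p mu x by rewrite level_gt0.
  by rewrite (ge_inf (level_has_inf p hmu').2)// (ub_le_sup (level_has_sup p hmu').2).
have Hl := level_lower p hmu; have Hu := level_upper p hmu.
move: lx; rewrite le_eqVlt => /predU1P[<-//|lx].
have lu := lt_le_trans lx xu.
have d0 : 0 < upper p mu - lower p mu by rewrite subr_gt0.
pose g := (upper p mu - x) / (upper p mu - lower p mu).
have -> : x = g * lower p mu + (1 - g) * upper p mu.
  have : g * (upper p mu - lower p mu) = upper p mu - x by rewrite divfK ?gt_eqF.
  by rewrite mulrBr mulrBl mul1r; lra.
apply: le_trans (membership_convex p _ _ _); first by rewrite le_min Hl Hu.
rewrite divr_ge0 ?subr_ge0 ?(ltW lu)//= ler_pdivrMr// mul1r.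
by rewrite lerD2l lerN2 ltW.
Qed.

Lemma lower_le_upper p mu : 0 <= mu <= 1 -> lower p mu <= upper p mu.
Proof.
move=> h; have [x px] := level_neq0 p h.
apply: (@le_trans _ _ x); first exact: (ge_inf (level_has_inf p h).2).
exact: (ub_le_sup (level_has_sup p h).2).
Qed.

Lemma fuzzy_eqP p q :
  (forall mu, 0 <= mu <= 1 -> lower p mu = lower q mu) ->
  (forall mu, 0 <= mu <= 1 -> upper p mu = upper q mu) -> p = q.
Proof.
move=> hl hu; apply: fuzzy_ext => x.
have h mu : 0 < mu <= 1 -> (mu <= p x) = (mu <= q x).
  move=> hmu; have /andP[mu0 mu1] := hmu.
  by rewrite !levelP// hl ?hu// (ltW mu0).
have le (r s : fuzzy_number R) : (forall mu, 0 < mu <= 1 ->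
    (mu <= r x) = (mu <= s x)) -> r x <= s x.
  move=> rs; have /andP[r0 r1] := membership_itv r x.
  move: r0; rewrite le_eqVlt => /predU1P[<-|r0].
    by have /andP[] := membership_itv s x.
  by rewrite -rs ?r0 ?r1.
by apply/le_anti; rewrite !le//= => mu /h.
Qed.

(* The conditions characterising the lower endpoint functions of fuzzy
   numbers, in order form: non-decreasing on [0, 1], left continuous on ]0, 1]
   and right continuous at 0. Upper endpoint functions are the opposites of
   such functions. *)
Definition endpoint (l : R -> R) := [/\
  forall m n : R, 0 <= m -> m <= n -> n <= 1 -> l m <= l n,
  forall m x : R, 0 < m <= 1 -> (forall n : R, 0 <= n < m -> l n <= x) -> l m <= x &
  forall x : R, (forall n : R, 0 < n <= 1 -> x <= l n) -> x <= l 0].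

Lemma endpoint_lower p : endpoint (lower p).
Proof.
split=> [m n m0 mn n1|m x hm H|x H].
- have hm : 0 <= m <= 1 by rewrite m0 (le_trans mn).
  have hn : 0 <= n <= 1 by rewrite n1 (le_trans m0).
  apply: lb_le_inf; first exact: level_neq0.
  move=> y; move: m0; rewrite (le_eqVlt 0) => /predU1P[m0|m0].
    move=> /(level_sub0 (andP hn).1) py.
    by rewrite -m0; apply: (ge_inf (level_has_inf p _).2); rewrite ?lexx ?ler01.
  have n0 := lt_le_trans m0 mn; rewrite level_gt0// => py.
  apply: (ge_inf (level_has_inf p hm).2); rewrite level_gt0//=.
  exact: le_trans py.
- rewrite leNgt; apply/negP => xl.
  have /andP[m0 m1] := hm.
  have hn n : 0 < n < m -> n <= p x.
    case/andP=> n0 nm; have n1 : n <= 1 by rewrite (le_trans (ltW nm)).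
    rewrite levelP ?n0// H ?(ltW n0)//=; apply: le_trans (ltW xl) _.
    have := level_lower p hm => /(le_trans (ltW nm)).
    by rewrite levelP ?n0// => /andP[].
  suff : m <= p x by rewrite levelP// leNgt xl.
  rewrite leNgt; apply/negP => pm.
  have /andP[px0 _] := membership_itv p x.
  have := hn ((p x + m) / 2); rewrite leNgt.
  have -> : p x < (p x + m) / 2 by rewrite midf_lt.
  have -> : (p x + m) / 2 < m by rewrite midf_lt.
  by rewrite divr_gt0 ?ltr_wpDl// => /(_ isT).
- apply: lb_le_inf; first by apply: level_neq0; rewrite lexx ler01.
  rewrite /level eqxx.
  have cl : closed [set y : R | x <= y] by exact: closed_ge.
  suff : closure [set y | 0 < p y] `<=` [set y | x <= y] by move=> h y /h.
  rewrite closureE => y; apply; split => // z /= pz.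
  have /andP[_ p1] := membership_itv p z.
  apply: le_trans (H (p z) _) _; first by rewrite pz.
  by have := lexx (p z); rewrite levelP ?pz// => /andP[].
Qed.

Lemma endpoint_upper p : endpoint (fun m => - upper p m).
Proof.
split=> [m n m0 mn n1|m x hm H|x H].
- have hm : 0 <= m <= 1 by rewrite m0 (le_trans mn).
  have hn : 0 <= n <= 1 by rewrite n1 (le_trans m0).
  rewrite lerN2; apply: ge_sup; first exact: level_neq0.
  move=> y; move: m0; rewrite (le_eqVlt 0) => /predU1P[m0|m0].
    move=> /(level_sub0 (andP hn).1) py.
    by rewrite -m0; apply: (ub_le_sup (level_has_sup p _).2); rewrite ?lexx ?ler01.
  have n0 := lt_le_trans m0 mn; rewrite level_gt0// => py.
  apply: (ub_le_sup (level_has_sup p hm).2); rewrite level_gt0//=.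
  exact: le_trans py.
- rewrite lerNl leNgt; apply/negP => xl.
  have /andP[m0 m1] := hm.
  have hn n : 0 < n < m -> n <= p (- x).
    case/andP=> n0 nm; have n1 : n <= 1 by rewrite (le_trans (ltW nm)).
    rewrite levelP ?n0// (lerNl x) H ?(ltW n0)// andbT; apply: le_trans (ltW xl).
    have := level_upper p hm => /(le_trans (ltW nm)).
    by rewrite levelP ?n0// => /andP[].
  suff : m <= p (- x) by rewrite levelP// => /andP[_]; rewrite leNgt xl.
  rewrite leNgt; apply/negP => pm.
  have /andP[px0 _] := membership_itv p (- x).
  have := hn ((p (- x) + m) / 2); rewrite leNgt.
  have -> : p (- x) < (p (- x) + m) / 2 by rewrite midf_lt.
  have -> : (p (- x) + m) / 2 < m by rewrite midf_lt.
  by rewrite divr_gt0 ?ltr_wpDl// => /(_ isT).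
- rewrite lerNr; apply: ge_sup; first by apply: level_neq0; rewrite lexx ler01.
  rewrite /level eqxx.
  have cl : closed [set y : R | y <= - x] by exact: closed_le.
  suff : closure [set y | 0 < p y] `<=` [set y | y <= - x] by move=> h y /h.
  rewrite closureE => y; apply; split => // z /= pz.
  have /andP[_ p1] := membership_itv p z.
  rewrite lerNr; apply: le_trans (H (p z) _) _; first by rewrite pz.
  by rewrite lerN2; have := lexx (p z); rewrite levelP ?pz// => /andP[].
Qed.

Lemma endpoint_add l k : endpoint l -> endpoint k -> endpoint (fun m => l m + k m).
Proof.
move=> [l1 l2 l3] [k1 k2 k3]; split=> [m n *|m x hm H|x H].
- by rewrite lerD ?l1 ?k1.
- have /andP[m0 m1] := hm; rewrite -lerBrDr; apply: l2 => // n /andP[n0 nm].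
  rewrite lerBrDr addrC -lerBrDr; apply: k2 => // n' /andP[n'0 n'm].
  rewrite lerBrDr addrC; have [nn'|nn'] := leP n n'.
    apply: le_trans (H n' _); last by rewrite n'0.
    by rewrite lerD2r l1// (le_trans (ltW n'm)).
  apply: le_trans (H n _); last by rewrite n0.
  by rewrite lerD2l k1// ?(ltW nn')// (le_trans (ltW nm)).
- rewrite -lerBlDr; apply: l3 => n /andP[n0 n1].
  rewrite lerBlDr addrC -lerBlDr; apply: k3 => n' /andP[n'0 n'1].
  rewrite lerBlDr addrC; have [nn'|nn'] := leP n n'.
    by apply: le_trans (H n _) _; rewrite ?n0// lerD2l k1// ltW.
  by apply: le_trans (H n' _) _; rewrite ?n'0// lerD2r l1// ltW.
Qed.

Lemma endpoint_scale c l : 0 <= c -> endpoint l -> endpoint (fun m => c * l m).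
Proof.
move=> c0 [l1 l2 l3]; move: c0; rewrite le_eqVlt => /predU1P[<-|c0].
  split=> [m n|m x|x]; rewrite ?mul0r//.
    by move=> /andP[m0 m1] /(_ 0); rewrite mul0r lexx m0; apply.
  by move=> /(_ 1); rewrite mul0r lexx ltr01; apply.
split=> [m n *|m x hm H|x H].
- by rewrite ler_pM2l// l1.
- by rewrite mulrC -ler_pdivlMr//; apply: l2 => // n /H; rewrite mulrC -ler_pdivlMr.
- by rewrite mulrC -ler_pdivrMr//; apply: l3 => n /H; rewrite mulrC -ler_pdivrMr.
Qed.

Lemma endpoint_cst c : endpoint (fun=> c).
Proof.
split=> // [m x /andP[m0 m1] /(_ 0)|x /(_ 1)]; first by rewrite lexx m0; apply.
by rewrite lexx ltr01; apply.
Qed.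

Section of_endpoints.
Variables l u : R -> R.
Hypotheses (hl : endpoint l) (hu : endpoint (fun m => - u m)) (hlu : l 1 <= u 1).

(* The fuzzy number with prescribed endpoint functions: the membership degree
   of x is the largest mu such that x lies in [l mu, u mu], and 0 if there is
   none ([sup set0 = 0]). *)
Definition endpoints_membership (x : R) : R :=
  sup [set mu | 0 <= mu <= 1 /\ l mu <= x <= u mu].

Local Notation P := endpoints_membership.

Let lmono m n : 0 <= m -> m <= n -> n <= 1 -> l m <= l n.
Proof. by case: hl => + _ _; apply. Qed.

Let umono m n : 0 <= m -> m <= n -> n <= 1 -> u n <= u m.
Proof. by move=> *; rewrite -lerN2; case: hu => + _ _; apply. Qed.

Let ub x : has_ubound [set mu | 0 <= mu <= 1 /\ l mu <= x <= u mu].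
Proof. by exists 1 => mu /= [/andP[]]. Qed.

Let P_itv x : 0 <= P x <= 1.
Proof.
rewrite /P; set A := [set _ | _].
have [->|/set0P[m Am]] := eqVneq A set0.
  by rewrite sup0 lexx ler01.
rewrite (le_trans _ (ub_le_sup (ub x) Am)); last by case: Am => /andP[].
by apply: ge_sup; [exists m | move=> n [/andP[]]].
Qed.

Let PP mu x : 0 < mu <= 1 -> (mu <= P x) = (l mu <= x <= u mu).
Proof.
move=> hmu; have /andP[mu0 mu1] := hmu; apply/idP/idP => [muP|H]; last first.
  by apply: (ub_le_sup (ub x)); split; rewrite // (ltW mu0).
have key n : 0 <= n < mu -> l n <= x <= u n.
  case/andP=> n0 nmu.
  have hs : has_sup [set mu | 0 <= mu <= 1 /\ l mu <= x <= u mu].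
    split; last exact: ub.
    have [A0|/set0P//] := eqVneq [set mu | 0 <= mu <= 1 /\ l mu <= x <= u mu] set0.
    by move: muP; rewrite /P A0 sup0 leNgt mu0.
  have e0 : 0 < P x - n by rewrite subr_gt0 (lt_le_trans nmu).
  have [m [/andP[m0 m1] /andP[lm mu']]] := sup_adherent e0 hs.
  rewrite -/(P x) subKr => nm.
  by rewrite (le_trans (lmono _ (ltW nm) _) lm)// (le_trans mu')// umono// ltW.
case: hl hu => _ h _ [_ k _]; apply/andP; split.
  by apply: h => // n /key/andP[].
by rewrite -lerN2; apply: k => // n /key/andP[]; rewrite lerN2.
Qed.

Let P_normal : exists x, P x = 1.
Proof.
exists (l 1); apply/le_anti; have /andP[_ ->] := P_itv (l 1).
by rewrite /= PP ?ltr01 ?lexx.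
Qed.

Let P_convex x y g : 0 <= g <= 1 -> Num.min (P x) (P y) <= P (g * x + (1 - g) * y).
Proof.
case/andP=> g0 g1; have [m0|m0] := leP (Num.min (P x) (P y)) 0.
  by apply: le_trans m0 _; have /andP[] := P_itv (g * x + (1 - g) * y).
have m1 : Num.min (P x) (P y) <= 1.
  by rewrite ge_min; have /andP[_ ->] := P_itv x.
have hm : 0 < Num.min (P x) (P y) <= 1 by rewrite m0.
have : Num.min (P x) (P y) <= P x by rewrite ge_min lexx.
have : Num.min (P x) (P y) <= P y by rewrite ge_min lexx orbT.
rewrite !PP//; move: (Num.min _ _) => m /andP[ly yu] /andP[lx xu].
by apply/andP; split; nra.
Qed.

Let P_usc : upper_semicontinuous P.
Proof.
move=> x a Pa; have [a1|a1] := ltP 1 a.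
  by near=> y; have /andP[_ P1] := P_itv y; exact: le_lt_trans a1.
have a0 : 0 < a by apply: le_lt_trans Pa; have /andP[] := P_itv x.
have ha : 0 < a <= 1 by rewrite a0.
move: Pa; rewrite ltNge PP// negb_and -!ltNge => /orP[xl|ux].
  near=> y; rewrite ltNge PP// negb_and -!ltNge; apply/orP; left.
  by near: y; exact: lt_nbhsl.
near=> y; rewrite ltNge PP// negb_and -!ltNge; apply/orP; right.
by near: y; exact: lt_nbhsr.
Unshelve. all: by end_near. Qed.

Let P_supp : closure [set x | 0 < P x] `<=` [set x | l 0 <= x <= u 0].
Proof.
have cl : closed [set x | l 0 <= x <= u 0].
  have -> : [set x | l 0 <= x <= u 0] = `[l 0, u 0]%classic.
    by apply/seteqP; split=> x /=; rewrite in_itv.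
  exact: interval_closed.
rewrite closureE => y; apply; split => // x /= Px.
have /andP[_ P1] := P_itv x.
have := lexx (P x); rewrite PP ?Px// => /andP[lx xu].
rewrite (le_trans _ lx) ?(le_trans xu)//; first by apply: umono; rewrite // ltW.
by apply: lmono; rewrite // ltW.
Qed.

Let P_compact : compact (closure [set x | 0 < P x]).
Proof.
apply: (@subclosed_compact _ _ `[l 0, u 0]%classic).
- exact: closed_closure.
- exact: segment_compact.
- by move=> x /P_supp /=; rewrite in_itv.
Qed.

Definition of_endpoints : fuzzy_number R :=
  FuzzyNumber P_itv P_normal P_convex P_usc P_compact.

Let lu m : 0 <= m <= 1 -> l m <= u m.
Proof.
by case/andP=> m0 m1; rewrite (le_trans (lmono m0 m1 _))// (le_trans hlu)// umono.
Qed.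

Lemma of_endpoints_lower m : 0 <= m <= 1 -> lower of_endpoints m = l m.
Proof.
move=> hm; have /andP[] := hm; rewrite le_eqVlt => /predU1P[m0|m0] m1; last first.
  have hm' : 0 < m <= 1 by rewrite m0.
  apply/le_anti/andP; split.
    apply: (ge_inf (level_has_inf _ hm).2); rewrite level_gt0//=.
    by rewrite PP// lexx lu.
  apply: lb_le_inf; first exact: level_neq0.
  by move=> x; rewrite level_gt0//= PP// => /andP[].
subst m; apply/le_anti/andP; split; last first.
  apply: lb_le_inf; first exact: level_neq0.
  by move=> x; rewrite /level eqxx => /P_supp/andP[].
case: hl => _ _; apply => n /andP[n0 n1].
apply: (ge_inf (level_has_inf _ hm).2); rewrite /level eqxx.
apply: subset_closure => /=; apply: (lt_le_trans n0).
by rewrite PP ?n0// lexx lu// ltW.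
Qed.

Lemma of_endpoints_upper m : 0 <= m <= 1 -> upper of_endpoints m = u m.
Proof.
move=> hm; have /andP[] := hm; rewrite le_eqVlt => /predU1P[m0|m0] m1; last first.
  have hm' : 0 < m <= 1 by rewrite m0.
  apply/le_anti/andP; split; last first.
    apply: (ub_le_sup (level_has_sup _ hm).2); rewrite level_gt0//=.
    by rewrite PP// lexx lu.
  apply: ge_sup; first exact: level_neq0.
  by move=> x; rewrite level_gt0//= PP// => /andP[].
subst m; apply/le_anti/andP; split.
  apply: ge_sup; first exact: level_neq0.
  by move=> x; rewrite /level eqxx => /P_supp/andP[].
rewrite -lerN2; case: hu => _ _; apply => n /andP[n0 n1]; rewrite lerN2.
apply: (ub_le_sup (level_has_sup _ hm).2); rewrite /level eqxx.
apply: subset_closure => /=; apply: (lt_le_trans n0).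
by rewrite PP ?n0// lexx lu// ltW.
Qed.

End of_endpoints.
End parametric_form.

Section operations.
Context {R : realType}.
Implicit Types (p q r : fuzzy_number R) (g mu : R).

Fact endpoint_zero : endpoint (fun=> - (0 : R)). Proof. exact: endpoint_cst. Qed.

Definition fuzzy_zero : fuzzy_number R :=
  of_endpoints (endpoint_cst 0) endpoint_zero (lexx 0).

Lemma lower_zero mu : 0 <= mu <= 1 -> lower fuzzy_zero mu = 0.
Proof. exact: of_endpoints_lower. Qed.

Lemma upper_zero mu : 0 <= mu <= 1 -> upper fuzzy_zero mu = 0.
Proof. exact: of_endpoints_upper. Qed.

Lemma fuzzy_zeroE x : fuzzy_zero x = (x == 0)%:R.
Proof.
have /andP[z0 z1] := membership_itv fuzzy_zero x.
have [->|x0] := eqVneq x 0.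
  have /andP[_ h1] := membership_itv fuzzy_zero 0.
  apply/le_anti; rewrite h1 levelP ?ltr01 ?lexx//.
  by rewrite lower_zero ?upper_zero ?ler01 ?lexx.
apply/le_anti; rewrite z0 andbT leNgt; apply/negP => z_gt0.
have := lexx (fuzzy_zero x).
rewrite [X in is_true X]levelP ?z_gt0// lower_zero ?upper_zero ?z0//.
by move=> /le_anti/esym/eqP; rewrite (negPf x0).
Qed.

Fact endpoint_add_upper p q : endpoint (fun m => - (upper p m + upper q m)).
Proof.
under eq_fun do rewrite opprD.
by apply: endpoint_add; exact: endpoint_upper.
Qed.

Fact add_le p q : lower p 1 + lower q 1 <= upper p 1 + upper q 1.
Proof. by rewrite lerD// lower_le_upper// ler01 lexx. Qed.

Definition fuzzy_add p q : fuzzy_number R :=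
  of_endpoints (endpoint_add (endpoint_lower p) (endpoint_lower q))
    (endpoint_add_upper p q) (add_le p q).

Lemma lower_add p q mu : 0 <= mu <= 1 ->
  lower (fuzzy_add p q) mu = lower p mu + lower q mu.
Proof. exact: of_endpoints_lower. Qed.

Lemma upper_add p q mu : 0 <= mu <= 1 ->
  upper (fuzzy_add p q) mu = upper p mu + upper q mu.
Proof. exact: of_endpoints_upper. Qed.

Definition scale_lower g p mu := if 0 <= g then g * lower p mu else g * upper p mu.
Definition scale_upper g p mu := if 0 <= g then g * upper p mu else g * lower p mu.

Fact endpoint_scale_lower g p : endpoint (scale_lower g p).
Proof.
rewrite /scale_lower; case: (leP 0 g) => g0.
  by apply: endpoint_scale => //; exact: endpoint_lower.
under eq_fun do rewrite -mulrNN.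
by apply: endpoint_scale (endpoint_upper p); rewrite oppr_ge0 ltW.
Qed.

Fact endpoint_scale_upper g p : endpoint (fun m => - scale_upper g p m).
Proof.
rewrite /scale_upper; case: (leP 0 g) => g0.
  under eq_fun do rewrite -mulrN.
  by apply: endpoint_scale => //; exact: endpoint_upper.
under eq_fun do rewrite -mulNr.
by apply: endpoint_scale (endpoint_lower p); rewrite oppr_ge0 ltW.
Qed.

Fact scale_le g p : scale_lower g p 1 <= scale_upper g p 1.
Proof.
have h : lower p 1 <= upper p 1 by rewrite lower_le_upper// ler01 lexx.
rewrite /scale_lower /scale_upper; case: (leP 0 g) => g0; first exact: ler_wpM2l.
by rewrite ler_wnM2l// ltW.
Qed.

Definition fuzzy_scale g p : fuzzy_number R :=
  of_endpoints (endpoint_scale_lower g p) (endpoint_scale_upper g p)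
    (scale_le g p).

Lemma lower_scale g p mu : 0 <= mu <= 1 ->
  lower (fuzzy_scale g p) mu =
    if 0 <= g then g * lower p mu else g * upper p mu.
Proof. exact: of_endpoints_lower. Qed.

Lemma upper_scale g p mu : 0 <= mu <= 1 ->
  upper (fuzzy_scale g p) mu =
    if 0 <= g then g * upper p mu else g * lower p mu.
Proof. exact: of_endpoints_upper. Qed.

Lemma fuzzy_addA : associative fuzzy_add.
Proof.
by move=> p q r; apply: fuzzy_eqP => mu h; rewrite ?(lower_add, upper_add)// addrA.
Qed.

Lemma fuzzy_addC : commutative fuzzy_add.
Proof.
by move=> p q; apply: fuzzy_eqP => mu h; rewrite ?(lower_add, upper_add)// addrC.
Qed.

Lemma fuzzy_add0 : left_id fuzzy_zero fuzzy_add.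
Proof.
move=> p; apply: fuzzy_eqP => mu h.
  by rewrite lower_add// lower_zero// add0r.
by rewrite upper_add// upper_zero// add0r.
Qed.

Definition endpoint_gap p q mu : R :=
  Num.max `|lower p mu - lower q mu| `|upper p mu - upper q mu|.

Definition fuzzy_dist p q : R := sup [set endpoint_gap p q mu | mu in `[0, 1]].

Lemma endpoint_bounded p : exists M, forall mu, 0 <= mu <= 1 ->
  `|lower p mu| <= M /\ `|upper p mu| <= M.
Proof.
have [M hM] := level_bounded p; exists M => mu h.
have [x0 hx0] := level_neq0 p h.
have b x : level p mu x -> - M <= x <= M.
  by move=> /(level_sub0 (andP h).1)/hM; rewrite ler_norml.
have [hi hs] := (level_has_inf p h, level_has_sup p h).
rewrite !ler_norml; split; apply/andP; split.
- by apply: lb_le_inf hi.1 _ => x /b/andP[].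
- by apply: le_trans (ge_inf hi.2 hx0) _; have /andP[] := b _ hx0.
- by apply: le_trans (ub_le_sup hs.2 hx0); have /andP[] := b _ hx0.
- by apply: ge_sup hs.1 _ => x /b/andP[].
Qed.

Lemma fuzzy_dist_has_sup p q : has_sup [set endpoint_gap p q mu | mu in `[0, 1]].
Proof.
split; first by exists (endpoint_gap p q 0), 0; rewrite //= in_itv/= lexx ler01.
have [[M hM] [N hN]] := (endpoint_bounded p, endpoint_bounded q).
exists (M + N) => y [mu /=]; rewrite in_itv/= => h <-.
have [[M1 M2] [N1 N2]] := (hM _ h, hN _ h).
by rewrite ge_max; apply/andP; split; apply: le_trans (ler_normB _ _) (lerD _ _).
Qed.

Lemma endpoint_gap_le p q mu : 0 <= mu <= 1 -> endpoint_gap p q mu <= fuzzy_dist p q.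
Proof.
move=> h; apply: (ub_le_sup (fuzzy_dist_has_sup p q).2).
by exists mu; rewrite //= in_itv.
Qed.

Lemma fuzzy_dist_le p q (e : R) :
  (forall mu, 0 <= mu <= 1 -> endpoint_gap p q mu <= e) -> fuzzy_dist p q <= e.
Proof.
move=> h; apply: ge_sup; first exact: (fuzzy_dist_has_sup p q).1.
by move=> y [mu /=]; rewrite in_itv/= => /h + <-.
Qed.

Lemma fuzzy_dist_ge0 p q : 0 <= fuzzy_dist p q.
Proof.
have h : 0 <= (0 : R) <= 1 by rewrite lexx ler01.
by apply: le_trans (endpoint_gap_le p q h); rewrite le_max normr_ge0.
Qed.

Lemma fuzzy_distxx p : fuzzy_dist p p = 0.
Proof.
apply/le_anti; rewrite fuzzy_dist_ge0 andbT; apply: fuzzy_dist_le => mu _.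
by rewrite /endpoint_gap !subrr normr0 maxxx.
Qed.

Lemma fuzzy_dist_eq0 p q : fuzzy_dist p q = 0 -> p = q.
Proof.
move=> pq; have h mu : 0 <= mu <= 1 -> lower p mu = lower q mu /\ upper p mu = upper q mu.
  move=> /(endpoint_gap_le p q); rewrite pq ge_max !normr_le0 !subr_eq0.
  by move=> /andP[/eqP-> /eqP->].
by apply: fuzzy_eqP => mu /h[].
Qed.

Lemma fuzzy_dist_sym p q : fuzzy_dist p q = fuzzy_dist q p.
Proof.
rewrite /fuzzy_dist; congr (sup (_ @` _)); apply/funext => mu.
by rewrite /endpoint_gap distrC [X in Num.max _ X]distrC.
Qed.

Lemma fuzzy_dist_triangle q p r : fuzzy_dist p r <= fuzzy_dist p q + fuzzy_dist q r.
Proof.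
apply: fuzzy_dist_le => mu h.
have := endpoint_gap_le p q h; have := endpoint_gap_le q r h.
rewrite !ge_max => /andP[a b] /andP[c d]; apply/andP; split.
  by apply: le_trans (ler_distD (lower q mu) _ _) (lerD _ _).
by apply: le_trans (ler_distD (upper q mu) _ _) (lerD _ _).
Qed.

End operations.

HB.instance Definition _ (R : realType) := gen_eqMixin (fuzzy_number R).
HB.instance Definition _ (R : realType) := gen_choiceMixin (fuzzy_number R).
HB.instance Definition _ (R : realType) :=
  isPointed.Build (fuzzy_number R) fuzzy_zero.
HB.instance Definition _ (R : realType) :=
  GRing.isNmodule.Build (fuzzy_number R) fuzzy_addA fuzzy_addC fuzzy_add0.
HB.instance Definition _ (R : realType) :=
  isMetric.Build R (fuzzy_number R) fuzzy_distxx fuzzy_dist_eq0 fuzzy_dist_sym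
    fuzzy_dist_triangle.

Section integral.
Context {R : realType}.
Implicit Types (f : R -> fuzzy_number R) (a b : R) (s : seq R) (tag : nat -> R).

Definition fuzzy_norm (p : fuzzy_number R) : R := fuzzy_dist p 0.

(* [s] lists the partition points after [a]; [tag i] lies in the i-th cell.
   When a = b the only partition is the empty one. *)
Definition tagged_partition a b s tag :=
  itv_partition a b s /\
  forall i, (i < size s)%N -> (a :: s)`_i <= tag i <= s`_i.

Definition mesh_lt a s (rho : R) :=
  forall i, (i < size s)%N -> s`_i - (a :: s)`_i < rho.

Definition fuzzy_riemann_sum f a s tag : fuzzy_number R :=
  \sum_(i < size s) fuzzy_scale (s`_i - (a :: s)`_i) (f (tag i)).

Definition is_FRint f a b (I : fuzzy_number R) :=
  forall e, 0 < e -> exists2 rho, 0 < rho &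
    forall s tag, tagged_partition a b s tag -> mesh_lt a s rho ->
      fuzzy_dist (fuzzy_riemann_sum f a s tag) I < e.

Definition FRintegrable f a b := exists I, is_FRint f a b I.

(* The value is meaningful only under [FRintegrable f a b]. *)
Definition FRint f a b : fuzzy_number R := get [set I | is_FRint f a b I].

End integral.

Section volterra.
Context {R : realType}.
Variables (z1 z2 : R) (m : nat) (theta : nat -> R -> R) (K : nat -> R -> R -> R).
Variables (G : fuzzy_number R -> fuzzy_number R) (Y : R -> fuzzy_number R).
Implicit Types Z V : R -> fuzzy_number R.

(* Functions on [z1, z2] are represented by total functions on R, of which only
   the restriction to [z1, z2] is relevant. *)
Definition fuzzy_continuous : set (R -> fuzzy_number R) :=
  [set Z | {within `[z1, z2], continuous Z}].

Definition fuzzy_unif_dist Z V : R :=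
  sup [set fuzzy_dist (Z v) (V v) | v in `[z1, z2]].

Definition kernel_max (k : R -> R -> R) : R :=
  sup [set `|k r v| | r in `[z1, z2] & v in `[z1, z2]].

Definition volterra_integrand Z t v : R -> fuzzy_number R :=
  fun r => fuzzy_scale (K t r v) (G (Z r)).

Definition volterra_integrable Z :=
  forall v, z1 <= v <= z2 -> forall t, (1 <= t <= m)%N ->
    FRintegrable (volterra_integrand Z t v) (theta t.-1 v) (theta t v).

Definition volterra_rhs Z v : fuzzy_number R :=
  Y v + \sum_(1 <= t < m.+1)
    FRint (volterra_integrand Z t v) (theta t.-1 v) (theta t v).

Definition volterra_solution Z :=
  volterra_integrable Z /\ forall v, z1 <= v <= z2 -> Z v = volterra_rhs Z v.

Fixpoint successive_approximation n : R -> fuzzy_number R :=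
  if n is n'.+1 then volterra_rhs (successive_approximation n') else Y.

End volterra.

(* Main.v *)
Require Import Defs.
From HB Require Import structures.
From mathcomp Require Import all_boot all_order all_algebra.
From mathcomp Require Import all_classical all_reals all_analysis.
From mathcomp Require Import ring lra.

Set Implicit Arguments.
Unset Strict Implicit.
Unset Printing Implicit Defensive.

Import Order.TTheory GRing.Theory Num.Theory.
Import numFieldNormedType.Exports.

Local Open Scope classical_set_scope.
Local Open Scope ring_scope.

(** The right-hand side of the equation is an operator [T] on fuzzy-valued
    functions on [z1, z2], and the theorem is Banach's fixed point theorem for
    [T] in the uniform distance. If [Z] and [V] are at distance at most [B],
    the t-th integrands of [T Z v] and [T V v] are at distance at most
    [M_t L B], so their integrals over a cell of length
    [theta_t v - theta_(t-1) v] are at distance at most that length times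
    [M_t L B]; summing over [t] shows that [T] is [c]-Lipschitz
    ([volterra_rhs_dist]). The same computation against the zero integrand
    bounds the first increment of the iteration by [c M0 / L]
    ([volterra_rhs_dist_forcing]), and the error estimate is the sum of the
    tail of a geometric series ([picard_fixpoint]).

    What has to be built is the integral itself. Fuzzy numbers form a cone, not
    a group: there is no difference to take, and the additivity of the integral
    over intervals is of little help in comparing two integrals. All the
    estimates are therefore read off the endpoint functions. For each level
    [mu], the lower and the upper endpoint of a fuzzy number are reals that
    depend additively and 1-Lipschitz-continuously on it, and the fuzzy distance
    is the supremum of the distances of these reals. For a continuous
    fuzzy-valued [f], each endpoint of [f x] at a fixed level is a continuous
    real function of [x] and has a primitive [A]; by the mean value theorem on
    every cell, a Riemann sum of mesh less than [rho] differs from [A b - A a]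
    by at most [b - a] times the oscillation of [f] at scale [rho], whatever
    the level ([riemann_sum_primitive], [edge_riemann_sum_primitive]). Because
    this bound is uniform in the level and pairs of endpoint functions are
    closed under uniform limits ([fuzzy_unif_lim]), the numbers [A b - A a] are
    the endpoints of a fuzzy number, which is the integral
    ([unif_continuous_FRintegrable], [edge_FRint]). Estimates for integrals then
    become mean value inequalities for primitives ([FRint_dist],
    [FRint_dist_bounds]); the second one, where the limits of integration move,
    gives the continuity of [T Z].

    On the compact interval continuity is replaced by uniform continuity
    throughout, which makes the moduli explicit. *)

(** * The cone of fuzzy numbers inside the bounded functions *)

Section edges.
Context {R : realType}.
Implicit Types (p q : fuzzy_number R) (g mu : R) (b : bool).

(** The evaluations [edge b _ mu] at [mu] in [0, 1] are additive, commute with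
    nonnegative scalings and together determine the fuzzy number and the
    distance; so every identity or estimate that involves only nonnegative
    scalars reduces to one between reals, uniformly in [b] and [mu]. *)
Definition edge b p mu : R := if b then lower p mu else upper p mu.

Lemma edge0 b mu : 0 <= mu <= 1 -> edge b 0 mu = 0.
Proof. by case: b => h; [exact: lower_zero | exact: upper_zero]. Qed.

Lemma edgeD b p q mu : 0 <= mu <= 1 -> edge b (p + q) mu = edge b p mu + edge b q mu.
Proof. by case: b => h; [exact: lower_add | exact: upper_add]. Qed.

Lemma edge_sum b (I : Type) (r : seq I) (P : pred I) (F : I -> fuzzy_number R) mu :
  0 <= mu <= 1 ->
  edge b (\sum_(i <- r | P i) F i) mu = \sum_(i <- r | P i) edge b (F i) mu.
Proof.
move=> h; apply: (big_morph (fun p => edge b p mu)) => [p q|].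
  exact: edgeD.
exact: edge0.
Qed.

Lemma edgeZ b g p mu : 0 <= g -> 0 <= mu <= 1 ->
  edge b (fuzzy_scale g p) mu = g * edge b p mu.
Proof. by case: b => g0 h; rewrite /edge ?lower_scale ?upper_scale// g0. Qed.

Lemma edge_dist b p q mu : 0 <= mu <= 1 ->
  `|edge b p mu - edge b q mu| <= fuzzy_dist p q.
Proof.
move=> h; apply: le_trans (endpoint_gap_le p q h).
by rewrite /endpoint_gap le_max /edge; case: b; rewrite lexx ?orbT.
Qed.

Lemma edge_norm b p mu : 0 <= mu <= 1 -> `|edge b p mu| <= fuzzy_norm p.
Proof.
by move=> h; rewrite -[edge _ _ _]subr0 -(edge0 b h); exact: edge_dist.
Qed.

Lemma dist_edge_le p q (e : R) :
  (forall b mu, 0 <= mu <= 1 -> `|edge b p mu - edge b q mu| <= e) ->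
  fuzzy_dist p q <= e.
Proof.
move=> H; apply: fuzzy_dist_le => mu h; rewrite /endpoint_gap ge_max.
by rewrite (H true)// (H false).
Qed.

Lemma fuzzy_distD p q p' q' :
  fuzzy_dist (p + q) (p' + q') <= fuzzy_dist p p' + fuzzy_dist q q'.
Proof.
apply: dist_edge_le => b mu h; rewrite !edgeD// opprD addrACA.
by apply: le_trans (ler_normD _ _) (lerD _ _); exact: edge_dist.
Qed.

Lemma fuzzy_dist_sum (r : seq nat) (F F' : nat -> fuzzy_number R) :
  fuzzy_dist (\sum_(i <- r) F i) (\sum_(i <- r) F' i) <=
  \sum_(i <- r) fuzzy_dist (F i) (F' i).
Proof.
elim: r => [|i r ih]; first by rewrite !big_nil fuzzy_distxx.
by rewrite !big_cons; apply: le_trans (fuzzy_distD _ _ _ _) _; rewrite lerD2l.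
Qed.

Lemma fuzzy_distZl g p q : 0 <= g ->
  fuzzy_dist (fuzzy_scale g p) (fuzzy_scale g q) <= g * fuzzy_dist p q.
Proof.
move=> g0; apply: dist_edge_le => b mu h; rewrite !edgeZ// -mulrBr normrM.
by rewrite ger0_norm// ler_wpM2l// edge_dist.
Qed.

Lemma fuzzy_distZr g g' p : 0 <= g -> 0 <= g' ->
  fuzzy_dist (fuzzy_scale g p) (fuzzy_scale g' p) <= `|g - g'| * fuzzy_norm p.
Proof.
move=> g0 g'0; apply: dist_edge_le => b mu h; rewrite !edgeZ// -mulrBl normrM.
by rewrite ler_wpM2l// edge_norm.
Qed.

Lemma fuzzy_normZ g p : 0 <= g -> fuzzy_norm (fuzzy_scale g p) <= g * fuzzy_norm p.
Proof.
move=> g0; apply: dist_edge_le => b mu h; rewrite edgeZ// edge0// subr0 normrM.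
by rewrite ger0_norm// ler_wpM2l// edge_norm.
Qed.

Lemma fuzzy_norm_dist p q : `|fuzzy_norm p - fuzzy_norm q| <= fuzzy_dist p q.
Proof.
have := fuzzy_dist_triangle q p 0; have := fuzzy_dist_triangle p q 0.
by rewrite (fuzzy_dist_sym q p) /fuzzy_norm ler_norml; lra.
Qed.

(** The three conditions on an endpoint function are weak inequalities between
    its values, hence stable under uniform limits. *)
Lemma endpoint_unif_lim (l : R -> R) :
  (forall e, 0 < e -> exists2 k, endpoint k &
    forall mu, 0 <= mu <= 1 -> `|k mu - l mu| <= e) -> endpoint l.
Proof.
move=> H; split=> [m n m0 mn n1|m x hm Hx|x Hx].
- apply/ler_addgt0Pr => e e0; have e20 : 0 < e / 2 by rewrite divr_gt0.
  have [k [k1 _ _] kl] := H _ e20.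
  have hm : 0 <= m <= 1 by rewrite m0 (le_trans mn).
  have hn : 0 <= n <= 1 by rewrite n1 (le_trans m0).
  have := k1 _ _ m0 mn n1; have := kl _ hm; have := kl _ hn.
  by rewrite !ler_norml; lra.
- have /andP[m0 m1] := hm.
  apply/ler_addgt0Pr => e e0; have e20 : 0 < e / 2 by rewrite divr_gt0.
  have [k [_ k2 _] kl] := H _ e20.
  have : k m <= x + e / 2.
    apply: k2 => // n nm; have := Hx _ nm; have /andP[n0 nm'] := nm.
    have := kl n; rewrite n0 (le_trans (ltW nm'))// => /(_ isT).
    by rewrite ler_norml; lra.
  by have := kl m; rewrite (ltW m0) m1 => /(_ isT); rewrite ler_norml; lra.
- apply/ler_addgt0Pr => e e0; have e20 : 0 < e / 2 by rewrite divr_gt0.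
  have [k [_ _ k3] kl] := H _ e20.
  have : x - e / 2 <= k 0.
    apply: k3 => n hn; have := Hx _ hn; have /andP[n0 n1] := hn.
    have := kl n; rewrite (ltW n0) n1 => /(_ isT).
    by rewrite ler_norml; lra.
  by have := kl 0; rewrite lexx ler01 => /(_ isT); rewrite ler_norml; lra.
Qed.

(** The cone of endpoint pairs is closed for uniform convergence. Both the
    completeness of the metric and the existence of integrals come from here. *)
Lemma fuzzy_unif_lim (J : bool -> R -> R) :
  (forall e, 0 < e -> exists p, forall b mu, 0 <= mu <= 1 ->
    `|edge b p mu - J b mu| <= e) ->
  exists p, forall b mu, 0 <= mu <= 1 -> edge b p mu = J b mu.
Proof.
move=> H.
have hl : endpoint (J true).
  apply: endpoint_unif_lim => e /H[p hp]; exists (lower p).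
    exact: endpoint_lower.
  by move=> mu /(hp true).
have hu : endpoint (fun m => - J false m).
  apply: endpoint_unif_lim => e /H[p hp]; exists (fun m => - upper p m).
    exact: endpoint_upper.
  by move=> mu /(hp false); rewrite -opprD normrN.
have h1 : 0 <= (1 : R) <= 1 by rewrite ler01 lexx.
have hlu : J true 1 <= J false 1.
  apply/ler_addgt0Pr => e e0; have e20 : 0 < e / 2 by rewrite divr_gt0.
  have [p hp] := H _ e20; have := lower_le_upper p h1.
  have := hp true _ h1; have := hp false _ h1.
  by rewrite /edge !ler_norml; lra.
exists (of_endpoints hl hu hlu) => -[] mu h.
  exact: of_endpoints_lower.
exact: of_endpoints_upper.
Qed.

(** A quantitative form of completeness: the limit inherits the Cauchy bound [w],
    which is how the error estimate of the iteration reaches the solution. *)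
Lemma fuzzy_complete (u : nat -> fuzzy_number R) (w : nat -> R) :
  (forall e, 0 < e -> exists n, w n <= e) ->
  (forall m n, (m <= n)%N -> fuzzy_dist (u m) (u n) <= w m) ->
  exists p, forall n, fuzzy_dist (u n) p <= w n.
Proof.
move=> w0 uw.
(* the intervals of radius w n around the values at rank n pairwise meet, so
   the supremum of their left ends lies in all of them *)
pose J b mu := sup [set edge b (u n) mu - w n | n in [set: nat]].
have wge0 n : 0 <= w n by apply: le_trans (uw n n (leqnn n)); exact: fuzzy_dist_ge0.
have uw' b mu m n : 0 <= mu <= 1 -> edge b (u n) mu - w n <= edge b (u m) mu + w m.
  move=> h; have [mn|/ltnW nm] := leqP m n.
    have := le_trans (edge_dist b (u m) (u n) h) (uw _ _ mn).
    by have := wge0 n; rewrite ler_norml; lra.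
  have := le_trans (edge_dist b (u n) (u m) h) (uw _ _ nm).
  by have := wge0 m; rewrite ler_norml; lra.
have uJ n b mu : 0 <= mu <= 1 -> `|edge b (u n) mu - J b mu| <= w n.
  move=> h.
  have J1 : J b mu <= edge b (u n) mu + w n.
    apply: ge_sup; first by exists (edge b (u 0%N) mu - w 0%N), 0%N.
    by move=> _ [m _ <-]; exact: uw'.
  have J2 : edge b (u n) mu - w n <= J b mu.
    apply: ub_le_sup; last by exists n.
    by exists (edge b (u n) mu + w n) => _ [m _ <-]; exact: uw'.
  by rewrite ler_norml; move: J1 J2; lra.
have [p hp] : exists p, forall b mu, 0 <= mu <= 1 -> edge b p mu = J b mu.
  apply: fuzzy_unif_lim => e /w0[n wn]; exists (u n) => b mu h.
  exact: le_trans (uJ _ _ _ h) wn.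
by exists p => n; apply: dist_edge_le => b mu h; rewrite hp// uJ.
Qed.

End edges.

(** * Uniform continuity on compact sets *)

Section unif_continuity.
Context {R : realType}.

Definition unif_continuous_on (T M : pseudoMetricType R) (A : set T) (f : T -> M) :=
  forall e, 0 < e -> exists2 d, 0 < d &
    forall x y, A x -> A y -> ball x d y -> ball (f x) e (f y).

(** Heine-Cantor; the near-covering form of compactness turns the pointwise
    moduli into a common one without extracting a finite subcover. *)
Lemma compact_unif_continuous (T M : pseudoMetricType R) (A : set T) (f : T -> M) :
  compact A -> {within A, continuous f} -> unif_continuous_on A f.
Proof.
move=> /compact_near_coveringP cA /subspace_continuousP cf e e0.
have e20 : 0 < e / 2 by rewrite divr_gt0.
pose P (d : R) (x : T) := A x -> forall y, A y -> ball x d y -> ball (f x) e (f y).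
have H : \forall d \near 0^'+, A `<=` P d.
  apply: cA => x Ax.
  have /nbhs_ballP[d /= d0 hd] : \forall z \near x, A z -> ball (f x) (e / 2) (f z).
    by have := cf x Ax _ (nbhsx_ballx (f x) _ e20).
  have d20 : 0 < d / 2 by rewrite divr_gt0.
  exists (ball x (d / 2), [set r : R | r < d / 2]).
    split=> /=; first exact: nbhsx_ballx.
    exact: nbhs_right_lt.
  move=> [x' r] /= [xx' rd] Ax' y Ay x'y.
  have fx : ball (f x) (e / 2) (f x').
    by apply: hd => //; apply: le_ball xx'; rewrite ler_pdivrMr// mulr2n; lra.
  have fy : ball (f x) (e / 2) (f y).
    apply: hd => //; apply: ball_split xx' _.
    by apply: le_ball x'y; exact: ltW.
  by apply: ball_split fy; exact: ball_sym.
have [d [d0 Hd]] : exists d, 0 < d /\ A `<=` P d.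
  near (0 : R)^'+ => d; exists d; split; first by near: d; exact: nbhs_right_gt.
  by near: d.
by exists d => // x y Ax Ay; exact: Hd.
Unshelve. all: by end_near. Qed.

Lemma unif_continuous_within (T M : pseudoMetricType R) (A : set T) (f : T -> M) :
  unif_continuous_on A f -> {within A, continuous f}.
Proof.
move=> cf; apply/subspace_continuousP => x Ax; apply/cvg_ballP => e e0.
have [d d0 hd] := cf e e0.
by apply/nbhs_ballP; exists d => //= y xy Ay; exact: hd.
Qed.

Lemma unif_continuous_bounded (T : pseudoMetricType R) (A : set T) (f : T -> R) :
  compact A -> unif_continuous_on A f ->
  exists2 B, 0 <= B & forall x, A x -> `|f x| <= B.
Proof.
move=> cA /unif_continuous_within cf.
have [B [_ hB]] := compact_bounded (continuous_compact cf cA).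
exists (Num.max 0 (B + 1)) => [|x Ax]; first by rewrite le_max lexx.
by apply: (hB _ _ (f x)); [rewrite lt_max ltrDl ltr01 orbT | exists x].
Qed.

Lemma unif_continuous_onS (T M : pseudoMetricType R) (D D' : set T) (f : T -> M) :
  D' `<=` D -> unif_continuous_on D f -> unif_continuous_on D' f.
Proof.
move=> DD' cf e /cf[d d0 hd]; exists d => // x y /DD' Dx /DD' Dy; exact: hd.
Qed.

End unif_continuity.

(** * Riemann sums and primitives of real functions *)

Section real_riemann.
Context {R : realType}.
Implicit Types (l A : R -> R) (a b : R) (s : seq R).

Definition primitive_on (D : set R) l A := forall x, D x -> is_derive x 1 A (l x).

(** Extending [l] by its boundary values makes the primitive differentiable
    from both sides at [z1] and [z2]. *)
Lemma primitive_exists (z1 z2 : R) l : z1 <= z2 -> unif_continuous_on `[z1, z2] l ->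
  exists A, primitive_on `[z1, z2] l A.
Proof.
move=> z12 cl.
pose k (x : R) : R := Num.max z1 (Num.min z2 x).
have kitv (x : R) : `[z1, z2]%classic (k x).
  by rewrite /= in_itv /= /k le_max lexx ge_max z12 ge_min lexx.
have kid (x : R) : `[z1, z2]%classic x -> k x = x.
  by rewrite /= in_itv /= /k => /andP[x1 x2]; rewrite (min_r x2) (max_r x1).
have klip (x y : R) : `|k x - k y| <= `|x - y|.
  have := lexx `|x - y|; rewrite {1}ler_norml; move: `|x - y| => N /andP[N1 N2].
  rewrite /k !maxEle !minEle.
  case: (leP z2 x) => ?; case: (leP z2 y) => ?;
    case: (leP z1 z2) => ?; case: (leP z1 x) => ?; case: (leP z1 y) => ?;
    rewrite ler_norml; lra.
have cont : continuous (l \o k).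
  move=> x; apply/cvg_ballP => e /cl[d d0 hd].
  apply/nbhs_ballP; exists d => //= y xy; apply: hd => //.
  exact: le_lt_trans (klip _ _) xy.
(* starting the integral before z1 puts z1 among the interior points, where the
   fundamental theorem applies *)
pose A x := (\int[lebesgue_measure]_(t in `[(z1 - 1)%R, x]) (l \o k) t)%R.
exists A => x xz.
have := xz; rewrite /= in_itv/= => /andP[x1 x2].
have xu : x < z2 + 1 by rewrite (le_lt_trans x2)// ltrDl.
have int : (@lebesgue_measure R).-integrable `[(z1 - 1)%R, (z2 + 1)%R]
    (EFin \o (l \o k)).
  apply: continuous_compact_integrable; first exact: segment_compact.
  exact: continuous_subspaceT.
have ax : z1 - 1 < x by rewrite ltrBlDr (le_lt_trans x1)// ltrDl.
have [dA A'] := continuous_FTC1_closed xu int ax (cont x).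
by apply: DeriveDef dA _; rewrite -derive1E A' /= kid.
Qed.

Lemma primitive_mean_value a b l A : a <= b -> primitive_on `[a, b] l A ->
  exists2 x, a <= x <= b & A b - A a = l x * (b - a).
Proof.
move=> ab dA.
have [x xab ->] : exists2 c, c \in `[a, b]%R & A b - A a = l c * (b - a).
  apply: MVT_segment => // [x /subset_itv_oo_cc|]; first exact: dA.
  apply: continuous_in_subspaceT => x; rewrite inE => /dA[+ _].
  by move=> /derivable1_diffP/differentiable_continuous.
by exists x.
Qed.

Lemma primitive_lipschitz a b (l A : R -> R) B x y : primitive_on `[a, b] l A ->
  (forall r, a <= r <= b -> `|l r| <= B) -> a <= x <= b -> a <= y <= b ->
  `|A x - A y| <= B * `|x - y|.
Proof.
move=> dA lB; wlog yx : x y / y <= x => [H hx hy|/andP[ax xb] /andP[ay yb]].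
  have [yx|/ltW xy] := leP y x; first exact: H.
  by rewrite distrC [`|x - y|]distrC; exact: H.
have [r /andP[yr rx] ->] : exists2 r, y <= r <= x & A x - A y = l r * (x - y).
  apply: primitive_mean_value => // r; rewrite /= in_itv/= => /andP[yr rx].
  by apply: dA; rewrite /= in_itv/= (le_trans ay)// (le_trans rx).
rewrite normrM ler_wpM2r// lB// (le_trans ay)// (le_trans rx)//.
Qed.

Lemma itv_partition_nth_itv a b s i : itv_partition a b s ->
  (i <= size s)%N -> a <= (a :: s)`_i <= b.
Proof.
move=> sp si; rewrite (set_nth_default b)//.
by rewrite (itv_partition_nth_ge _ sp)// (itv_partition_nth_le _ sp).
Qed.

Lemma itv_partition_nth_lt a b s i : itv_partition a b s ->
  (i < size s)%N -> (a :: s)`_i < s`_i.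
Proof. by case=> /(pathP 0)h _; exact: h. Qed.

Lemma itv_partition_telescope a b s A : itv_partition a b s ->
  \sum_(i < size s) (A s`_i - A (a :: s)`_i) = A b - A a.
Proof.
move=> sp; have := telescope_sumr (fun i => A (a :: s)`_i) (leq0n (size s)).
by rewrite big_mkord /= (itv_partition_nth_size _ sp).
Qed.

(** On each cell the increment of [A] is, by the mean value theorem, a value of
    [l] times the length of the cell. *)
Lemma riemann_sum_primitive a b s tag l A rho e :
  tagged_partition a b s tag -> mesh_lt a s rho -> primitive_on `[a, b] l A ->
  (forall x y, a <= x <= b -> a <= y <= b -> `|x - y| < rho -> `|l x - l y| <= e) ->
  `|\sum_(i < size s) (s`_i - (a :: s)`_i) * l (tag i) - (A b - A a)| <=
  e * (b - a).
Proof.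
move=> [sp tagP] mesh dA le.
rewrite -(itv_partition_telescope A sp) -(itv_partition_telescope idfun sp).
rewrite -sumrB mulr_sumr; apply: le_trans (ler_norm_sum _ _ _) _.
apply: ler_sum => i _ /=.
have /andP[ai ib] := itv_partition_nth_itv sp (ltnW (ltn_ord i)).
have /andP[ai' ib'] : a <= s`_i <= b := itv_partition_nth_itv sp (ltn_ord i).
have lt := itv_partition_nth_lt sp (ltn_ord i).
have /andP[t1 t2] := tagP _ (ltn_ord i).
have [x /andP[x1 x2] ->] : exists2 x, (a :: s)`_i <= x <= s`_i &
    A s`_i - A (a :: s)`_i = l x * (s`_i - (a :: s)`_i).
  apply: primitive_mean_value; first exact: ltW.
  move=> x; rewrite /= in_itv/= => /andP[? ?]; apply: dA.
  by rewrite /= in_itv/=; apply/andP; split; lra.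
rewrite [l x * _]mulrC -mulrBr normrM mulrC [X in _ * X]gtr0_norm ?subr_gt0//.
rewrite ler_wpM2r ?subr_ge0 ?(ltW lt)//; apply: le.
- by apply/andP; split; lra.
- by apply/andP; split; lra.
- by have := mesh _ (ltn_ord i); rewrite ltr_norml; lra.
Qed.

Lemma fine_partition_exists a b rho : a <= b -> 0 < rho ->
  exists s tag, tagged_partition a b s tag /\ mesh_lt a s rho.
Proof.
move=> ab rho0.
suff [s sp mesh] : exists2 s, itv_partition a b s & mesh_lt a s rho.
  exists s, (fun i => (a :: s)`_i); split => //; split => // i si.
  by rewrite lexx ltW// (itv_partition_nth_lt sp).
(* cells of length rho / 2, started from a, until b is reached *)
have [n] : exists n, b - a < n%:R * (rho / 2).
  exists (Num.truncn ((b - a) / (rho / 2))).+1.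
  by rewrite -ltr_pdivrMr ?divr_gt0// truncnS_gt.
elim: n a ab => [|n ih] a ab; first by rewrite mul0r subr_lt0 ltNge ab.
move: (ab); rewrite le_eqVlt => /predU1P[<- _|ab'].
  by exists [::] => //; split=> /=.
have [bn _|bn hn] := leP b (a + rho / 2).
  exists [:: b]; first exact: itv_partition1.
  by case=> // _ /=; lra.
have [||s [ps ls] ms] := ih (a + rho / 2); [exact: ltW | | ].
  by move: hn; rewrite -natr1; lra.
exists (a + rho / 2 :: s).
  by split=> //=; rewrite ltrDl divr_gt0.
case=> [_|i /ms]; last by [].
by rewrite /=; lra.
Qed.

End real_riemann.

(** * The fuzzy Riemann integral of a uniformly continuous function *)

Section fuzzy_riemann.
Context {R : realType}.
Implicit Types (f g : R -> fuzzy_number R) (a b e mu : R) (c : bool).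

Lemma edge_unif_continuous c mu (D : set R) f : 0 <= mu <= 1 ->
  unif_continuous_on D f -> unif_continuous_on D (fun x => edge c (f x) mu).
Proof.
move=> h cf e /cf[d d0 hd]; exists d => // x y Dx Dy /(hd _ _ Dx Dy).
exact: le_lt_trans (edge_dist _ _ _ h).
Qed.

Lemma edge_primitive_exists c mu a b f : a <= b -> 0 <= mu <= 1 ->
  unif_continuous_on `[a, b] f ->
  exists A, primitive_on `[a, b] (fun x => edge c (f x) mu) A.
Proof. by move=> ab h cf; apply/primitive_exists/edge_unif_continuous. Qed.

Lemma edge_riemann_sum c mu f a b s tag : 0 <= mu <= 1 ->
  itv_partition a b s ->
  edge c (fuzzy_riemann_sum f a s tag) mu =
  \sum_(i < size s) (s`_i - (a :: s)`_i) * edge c (f (tag i)) mu.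
Proof.
move=> h sp; rewrite edge_sum//; apply: eq_bigr => i _.
by rewrite edgeZ// subr_ge0 ltW// (itv_partition_nth_lt sp).
Qed.

(** The distance between [f x] and [f y] bounds all edges at once, so the rate
    of convergence of Riemann sums does not depend on the level. *)
Lemma edge_riemann_sum_primitive a b f e : a <= b ->
  unif_continuous_on `[a, b] f -> 0 < e ->
  exists2 rho, 0 < rho & forall s tag,
    tagged_partition a b s tag -> mesh_lt a s rho ->
    forall c mu A, 0 <= mu <= 1 ->
      primitive_on `[a, b] (fun x => edge c (f x) mu) A ->
      `|edge c (fuzzy_riemann_sum f a s tag) mu - (A b - A a)| <= e.
Proof.
move=> ab cf e0.
(* the summand 1 covers the degenerate interval a = b *)
have ba1 : 0 < b - a + 1 by rewrite ltr_wpDl// subr_ge0.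
have e'0 : 0 < e / (b - a + 1) by rewrite divr_gt0.
have [rho rho0 hrho] := cf _ e'0; exists rho => // s tag sp mesh c mu A h dA.
rewrite (edge_riemann_sum _ _ _ h sp.1).
apply: le_trans (riemann_sum_primitive (e := e / (b - a + 1)) sp mesh dA _) _.
  move=> x y xab yab xy; apply: le_trans (edge_dist _ _ _ h) _.
  by apply/ltW/hrho; rewrite //= in_itv.
by rewrite mulrAC ler_pdivrMr// ler_wpM2l ?(ltW e0)// lerDl.
Qed.

Lemma unif_continuous_FRintegrable a b f : a <= b ->
  unif_continuous_on `[a, b] f -> FRintegrable f a b.
Proof.
move=> ab cf.
have /choice[A dA] : forall cm : bool * R, exists A, 0 <= cm.2 <= 1 ->
    primitive_on `[a, b] (fun x => edge cm.1 (f x) cm.2) A.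
  move=> [c mu] /=; have [h|_] := boolP (0 <= mu <= 1); last by exists idfun.
  by have [A dA] := edge_primitive_exists c ab h cf; exists A.
have [I hI] : exists I, forall c mu, 0 <= mu <= 1 ->
    edge c I mu = A (c, mu) b - A (c, mu) a.
  apply: (@fuzzy_unif_lim _ (fun c mu => A (c, mu) b - A (c, mu) a)) => e e0.
  have [rho rho0 hrho] := edge_riemann_sum_primitive ab cf e0.
  have [s [tag [sp mesh]]] := fine_partition_exists ab rho0.
  exists (fuzzy_riemann_sum f a s tag) => c mu h.
  by apply: hrho => //; exact: (dA (c, mu)).
exists I => e e0; have e20 : 0 < e / 2 by rewrite divr_gt0.
have [rho rho0 hrho] := edge_riemann_sum_primitive ab cf e20.
exists rho => // s tag sp mesh.
apply: (@le_lt_trans _ _ (e / 2)); last by rewrite ltr_pdivrMr// mulr2n; lra.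
apply: dist_edge_le => c mu h; rewrite hI//; apply: hrho => //.
exact: (dA (c, mu)).
Qed.

(** The parametric form of the integral is given by ordinary integrals, here in
    the guise of increments of primitives. *)
Lemma edge_FRint a b f c mu A : a <= b -> unif_continuous_on `[a, b] f ->
  0 <= mu <= 1 -> primitive_on `[a, b] (fun x => edge c (f x) mu) A ->
  edge c (FRint f a b) mu = A b - A a.
Proof.
move=> ab cf h dA.
have hI : is_FRint f a b (FRint f a b).
  exact: (getPex (unif_continuous_FRintegrable ab cf)).
apply/eqP; rewrite -subr_eq0 -normr_le0; apply/ler_addgt0Pl => e e0; rewrite addr0.
have e20 : 0 < e / 2 by rewrite divr_gt0.
have [r1 r10 h1] := edge_riemann_sum_primitive ab cf e20.
have [r2 r20 h2] := hI _ e20.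
have r0 : 0 < Num.min r1 r2 by rewrite lt_min r10.
have [s [tag [sp mesh]]] := fine_partition_exists ab r0.
have m1 : mesh_lt a s r1 by move=> i /mesh; rewrite lt_min => /andP[].
have m2 : mesh_lt a s r2 by move=> i /mesh; rewrite lt_min => /andP[].
have := h1 _ _ sp m1 _ _ _ h dA.
have := le_lt_trans (edge_dist c _ _ h) (h2 _ _ sp m2).
by rewrite !ler_norml ltr_norml; lra.
Qed.

Lemma FRint_dist a b f g B : a <= b ->
  unif_continuous_on `[a, b] f -> unif_continuous_on `[a, b] g ->
  (forall r, a <= r <= b -> fuzzy_dist (f r) (g r) <= B) ->
  fuzzy_dist (FRint f a b) (FRint g a b) <= B * (b - a).
Proof.
move=> ab cf cg fgB; apply: dist_edge_le => c mu h.
have [A1 d1] := edge_primitive_exists c ab h cf.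
have [A2 d2] := edge_primitive_exists c ab h cg.
rewrite (edge_FRint ab cf h d1) (edge_FRint ab cg h d2).
have d12 : primitive_on `[a, b] (fun x => edge c (f x) mu - edge c (g x) mu)
    (A1 - A2).
  by move=> x xab; apply: is_deriveB; [exact: d1|exact: d2].
have -> : A1 b - A1 a - (A2 b - A2 a) = A1 b - A2 b - (A1 a - A2 a) by ring.
rewrite -[X in _ <= _ * X]ger0_norm ?subr_ge0//.
apply: (primitive_lipschitz d12); rewrite ?lexx ?ab//.
by move=> r /fgB; apply: le_trans; exact: edge_dist.
Qed.

Lemma FRint_norm a b f B : a <= b -> unif_continuous_on `[a, b] f ->
  (forall r, a <= r <= b -> fuzzy_norm (f r) <= B) ->
  fuzzy_norm (FRint f a b) <= B * (b - a).
Proof.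
move=> ab cf fB; apply: dist_edge_le => c mu h.
have [A dA] := edge_primitive_exists c ab h cf.
rewrite (edge_FRint ab cf h dA) edge0// subr0.
rewrite -[X in _ <= _ * X]ger0_norm ?subr_ge0//.
apply: primitive_lipschitz dA _ _ _; rewrite ?lexx ?ab//.
by move=> r /fB; apply: le_trans; exact: edge_norm.
Qed.

(** Fuzzy numbers cannot be subtracted, so the difference of two integrals of
    [f] is not an integral of [f]; a primitive of each edge serves instead. *)
Lemma FRint_dist_bounds (z1 z2 : R) a b a' b' f B :
  z1 <= a -> a <= b -> b <= z2 -> z1 <= a' -> a' <= b' -> b' <= z2 ->
  unif_continuous_on `[z1, z2] f ->
  (forall r, z1 <= r <= z2 -> fuzzy_norm (f r) <= B) ->
  fuzzy_dist (FRint f a b) (FRint f a' b') <= B * (`|a - a'| + `|b - b'|).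
Proof.
move=> za ab bz za' ab' bz' cf fB; apply: dist_edge_le => c mu h.
have z12 : z1 <= z2 by rewrite (le_trans za)// (le_trans ab).
have [A dA] := edge_primitive_exists c z12 h cf.
have sub x y : z1 <= x -> y <= z2 -> `[x, y] `<=` `[z1, z2].
  move=> zx yz r; rewrite /= !in_itv/= => /andP[xr ry].
  by rewrite (le_trans zx)// (le_trans ry).
have prim x y : z1 <= x -> x <= y -> y <= z2 -> edge c (FRint f x y) mu = A y - A x.
  move=> zx xy yz; apply: edge_FRint => //.
    by apply: unif_continuous_onS cf; exact: sub.
  by move=> r /(sub _ _ zx yz); exact: dA.
rewrite !prim//.
have lB r : z1 <= r <= z2 -> `|edge c (f r) mu| <= B.
  by move=> /fB; apply: le_trans; exact: edge_norm.
have Ab : `|A b - A b'| <= B * `|b - b'|.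
  by apply: primitive_lipschitz dA lB _ _; apply/andP; split; lra.
have Aa : `|A a - A a'| <= B * `|a - a'|.
  by apply: primitive_lipschitz dA lB _ _; apply/andP; split; lra.
rewrite mulrDr; move: Aa Ab; rewrite !ler_norml; lra.
Qed.

End fuzzy_riemann.

(** * The Volterra operator *)

Section unif_small.
Context {R : realType} (T : pseudoMetricType R) (A : set T).
Implicit Types (d : T -> T -> R).

(** [unif_small d] says that [d x y] tends to 0 uniformly as [x] and [y]
    approach each other. For [d x y] the distance of [f x] and [f y] it is the
    uniform continuity of [f]; unlike the latter it passes through sums and
    bounds, which turns estimates into proofs of continuity. *)
Definition unif_small d :=
  forall e, 0 < e -> exists2 r, 0 < r &
    forall x y, A x -> A y -> ball x r y -> d x y < e.

Lemma unif_small_le d d' : unif_small d' ->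
  (forall x y, A x -> A y -> d x y <= d' x y) -> unif_small d.
Proof.
move=> sd' dd' e /sd'[r r0 hr]; exists r => // x y Ax Ay xy.
exact: le_lt_trans (dd' _ _ Ax Ay) (hr _ _ Ax Ay xy).
Qed.

Lemma unif_smallD d d' : unif_small d -> unif_small d' ->
  unif_small (fun x y => d x y + d' x y).
Proof.
move=> sd sd' e e0; have e20 : 0 < e / 2 by rewrite divr_gt0.
have [[r r0 hr] [r' r'0 hr']] := (sd _ e20, sd' _ e20).
exists (Num.min r r') => [|x y Ax Ay xy]; first by rewrite lt_min r0.
rewrite [e]splitr ltrD//.
  by apply: hr => //; apply: le_ball xy; rewrite ge_min lexx.
by apply: hr' => //; apply: le_ball xy; rewrite ge_min lexx orbT.
Qed.

Lemma unif_smallZ C d : 0 <= C -> unif_small d -> unif_small (fun x y => C * d x y).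
Proof.
move=> C0 sd e e0; have C1 : 0 < C + 1 by rewrite ltr_wpDl.
have [r r0 hr] := sd _ (divr_gt0 e0 C1).
exists r => // x y Ax Ay /(hr _ _ Ax Ay); rewrite ltr_pdivlMr//.
by have [d0|d0] := leP 0 (d x y); nra.
Qed.

Lemma unif_small_sum (s : seq nat) (d : nat -> T -> T -> R) :
  (forall t, t \in s -> unif_small (d t)) ->
  unif_small (fun x y => \sum_(t <- s) d t x y).
Proof.
elim: s => [_ e e0|t s ih H]; first by exists 1 => // x y; rewrite big_nil.
apply: (@unif_small_le _ (fun x y => d t x y + \sum_(t <- s) d t x y)).
  apply: unif_smallD; first by apply: H; rewrite mem_head.
  by apply: ih => u us; apply: H; rewrite in_cons us orbT.
by move=> x y _ _; rewrite big_cons.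
Qed.

End unif_small.

Section volterra_operator.
Context {R : realType} (z1 z2 : R) (m : nat).
Variables (theta : nat -> R -> R) (K : nat -> R -> R -> R).
Variables (G : fuzzy_number R -> fuzzy_number R) (Y : R -> fuzzy_number R).
Variable L : R.
Implicit Types (Z V : R -> fuzzy_number R).

Local Notation D := (`[z1, z2]%classic : set R).
Local Notation M t := (kernel_max z1 z2 (K t)).
Local Notation rhs := (volterra_rhs m theta K G Y).

Hypothesis z12 : z1 <= z2.
Hypothesis theta_uc : forall t, (t <= m)%N -> unif_continuous_on D (theta t).
Hypothesis theta_itv : forall t, (t <= m)%N ->
  forall v, D v -> z1 <= theta t v <= z2.
Hypothesis theta_le : forall t, (1 <= t <= m)%N ->
  forall v, D v -> theta t.-1 v <= theta t v.
Hypothesis K_uc : forall t, (1 <= t <= m)%N ->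
  unif_continuous_on (D `*` D) (fun rv : R * R => K t rv.1 rv.2).
Hypothesis K_ge0 : forall t, (1 <= t <= m)%N ->
  forall r v, D r -> D v -> 0 <= K t r v.
Hypothesis L_ge0 : 0 <= L.
Hypothesis G_lip : forall p q, fuzzy_dist (G p) (G q) <= L * fuzzy_dist p q.
Hypothesis Y_uc : unif_continuous_on D Y.

Let DP x : D x = (z1 <= x <= z2) :> Prop.
Proof. by rewrite /= in_itv. Qed.

Let D_z1 : D z1. Proof. by rewrite DP lexx. Qed.

Let compactD : compact D. Proof. exact: segment_compact. Qed.

Lemma kernel_le t r v : (1 <= t <= m)%N -> D r -> D v -> `|K t r v| <= M t.
Proof.
move=> tm Dr Dv.
have [B _ hB] := unif_continuous_bounded (compact_setX compactD compactD) (K_uc tm).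
apply: ub_le_sup; last by exists r => //; exists v.
by exists B => _ [r' Dr' [v' Dv' <-]]; exact: (hB (r', v')).
Qed.

Lemma kernel_max_ge0 t : (1 <= t <= m)%N -> 0 <= M t.
Proof. by move=> tm; apply: le_trans (kernel_le tm D_z1 D_z1). Qed.

(** The modulus of continuity in [v] that the moving kernel needs: uniform over
    the variable of integration. *)
Definition kernel_gap t v w := sup [set `|K t r v - K t r w| | r in D].

Lemma kernel_gap_le t r v w : (1 <= t <= m)%N -> D r -> D v -> D w ->
  `|K t r v - K t r w| <= kernel_gap t v w.
Proof.
move=> tm Dr Dv Dw; apply: ub_le_sup; last by exists r.
exists (M t + M t) => _ [r' Dr' <-].
by apply: le_trans (ler_normB _ _) (lerD _ _); exact: kernel_le.
Qed.

Lemma kernel_gap_small t : (1 <= t <= m)%N -> unif_small D (kernel_gap t).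
Proof.
move=> tm e e0; have e20 : 0 < e / 2 by rewrite divr_gt0.
have [d d0 hd] := K_uc tm e20; exists d => // v w Dv Dw vw.
apply: (@le_lt_trans _ _ (e / 2)); last by rewrite ltr_pdivrMr// mulr2n; lra.
apply: ge_sup; first by exists `|K t z1 v - K t z1 w|, z1.
move=> _ [r Dr <-]; apply/ltW.
by apply: (hd (r, v) (r, w)) => //; split => //; exact: ballxx.
Qed.

Lemma G_norm_bounded Z : unif_continuous_on D Z ->
  exists2 N, 0 <= N & forall r, D r -> fuzzy_norm (G (Z r)) <= N.
Proof.
move=> cZ.
have cG : unif_continuous_on D (fun r => fuzzy_norm (G (Z r))).
  apply: (unif_small_le (unif_smallZ L_ge0 cZ)) => x y _ _.
  exact: le_trans (fuzzy_norm_dist _ _) (G_lip _ _).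
have [N N0 hN] := unif_continuous_bounded compactD cG; exists N => // r /hN.
exact: le_trans (ler_norm _).
Qed.

Lemma integrand_norm Z t v r N : (1 <= t <= m)%N -> D v -> D r ->
  fuzzy_norm (G (Z r)) <= N ->
  fuzzy_norm (volterra_integrand K G Z t v r) <= M t * N.
Proof.
move=> tm Dv Dr ZN; have K0 := K_ge0 tm Dr Dv.
apply: le_trans (fuzzy_normZ _ K0) _; apply: ler_pM => //.
  exact: fuzzy_dist_ge0.
exact: le_trans (ler_norm _) (kernel_le tm Dr Dv).
Qed.

Lemma integrand_unif_continuous Z t v : unif_continuous_on D Z ->
  (1 <= t <= m)%N -> D v -> unif_continuous_on D (volterra_integrand K G Z t v).
Proof.
move=> cZ tm Dv.
have [N N0 hN] := G_norm_bounded cZ.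
have cK : unif_small D (fun r s => `|K t r v - K t s v|).
  move=> e /(K_uc tm)[d d0 hd]; exists d => // r s Dr Ds rs.
  by apply: (hd (r, v) (s, v)) => //; split => //; exact: ballxx.
have ML0 : 0 <= M t * L by rewrite mulr_ge0// kernel_max_ge0.
apply: (unif_small_le (unif_smallD (unif_smallZ ML0 cZ) (unif_smallZ N0 cK))).
move=> r s Dr Ds; have [Kr Ks] := (K_ge0 tm Dr Dv, K_ge0 tm Ds Dv).
apply: le_trans (fuzzy_dist_triangle (fuzzy_scale (K t r v) (G (Z s))) _ _) _.
apply: lerD.
  apply: le_trans (fuzzy_distZl _ _ Kr) _; rewrite -mulrA.
  apply: ler_pM => //; first exact: fuzzy_dist_ge0.
  exact: le_trans (ler_norm _) (kernel_le tm Dr Dv).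
by apply: le_trans (fuzzy_distZr _ Kr Ks) _; rewrite mulrC ler_wpM2r// hN.
Qed.

Lemma integrand_unif_continuous_cell Z t v : unif_continuous_on D Z ->
  (1 <= t <= m)%N -> D v ->
  unif_continuous_on `[theta t.-1 v, theta t v] (volterra_integrand K G Z t v).
Proof.
move=> cZ tm Dv; apply: unif_continuous_onS (integrand_unif_continuous cZ tm Dv).
have /andP[t1 t2] := tm.
have /andP[a1 _] := theta_itv (leq_trans (leq_pred t) t2) Dv.
have /andP[_ b2] := theta_itv t2 Dv.
move=> r; rewrite /= !in_itv/= => /andP[ar rb].
by rewrite (le_trans a1)// (le_trans rb).
Qed.

Lemma volterra_integrable_unif_continuous Z : unif_continuous_on D Z ->
  volterra_integrable z1 z2 m theta K G Z.
Proof.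
move=> cZ v vz t tm; have Dv : D v by rewrite DP.
apply: unif_continuous_FRintegrable; first exact: theta_le.
exact: integrand_unif_continuous_cell.
Qed.

(** As [v] varies, both the kernel and the limits of integration move; the
    intermediate integral keeps the limits at [v] and the kernel at [w]. *)
Lemma volterra_rhs_unif_continuous Z : unif_continuous_on D Z ->
  unif_continuous_on D (rhs Z).
Proof.
move=> cZ; have [N N0 hN] := G_norm_bounded cZ.
pose d t v w := N * (z2 - z1) * kernel_gap t v w +
  M t * N * (`|theta t.-1 v - theta t.-1 w| + `|theta t v - theta t w|).
have sd : unif_small D (fun v w => \sum_(1 <= t < m.+1) d t v w).
  apply: unif_small_sum => t; rewrite mem_index_iota ltnS => tm.
  have /andP[t1 t2] := tm.
  apply: unif_smallD; apply: unif_smallZ.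
  - by rewrite mulr_ge0// subr_ge0.
  - exact: kernel_gap_small.
  - by rewrite mulr_ge0// kernel_max_ge0.
  - apply: unif_smallD; apply: theta_uc => //.
    exact: leq_trans (leq_pred t) t2.
apply: (unif_small_le (unif_smallD Y_uc sd)) => v w Dv Dw.
apply: le_trans (fuzzy_distD _ _ _ _) _; rewrite lerD2l.
apply: le_trans (fuzzy_dist_sum _ _ _) _; rewrite !big_seq; apply: ler_sum => t.
rewrite mem_index_iota ltnS => tm; have /andP[t1 t2] := tm.
have t2' := leq_trans (leq_pred t) t2.
have [/andP[a1 a2] /andP[b1 b2]] := (theta_itv t2' Dv, theta_itv t2 Dv).
have [/andP[a'1 a'2] /andP[b'1 b'2]] := (theta_itv t2' Dw, theta_itv t2 Dw).
have ab := theta_le tm Dv; have a'b' := theta_le tm Dw.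
have sub : `[theta t.-1 v, theta t v] `<=` D.
  move=> r; rewrite /= !in_itv/= => /andP[ar rb].
  by rewrite (le_trans a1)// (le_trans rb).
pose mid := FRint (volterra_integrand K G Z t w) (theta t.-1 v) (theta t v).
apply: le_trans (fuzzy_dist_triangle mid _ _) _; apply: lerD; last first.
  apply: (FRint_dist_bounds (z1 := z1) (z2 := z2)) => //.
    exact: integrand_unif_continuous.
  move=> r rD; have Dr : D r by rewrite DP.
  by apply: integrand_norm => //; exact: hN.
apply: (@le_trans _ _ (kernel_gap t v w * N * (theta t v - theta t.-1 v))).
  apply: FRint_dist => //; first exact: integrand_unif_continuous_cell.
    exact: unif_continuous_onS sub (integrand_unif_continuous cZ tm Dw).
  move=> r rab; have Dr : D r by apply: sub; rewrite /= in_itv.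
  apply: le_trans (fuzzy_distZr _ (K_ge0 tm Dr Dv) (K_ge0 tm Dr Dw)) _.
  by apply: ler_pM => //; [exact: fuzzy_dist_ge0|exact: kernel_gap_le|exact: hN].
have g0 : 0 <= kernel_gap t v w := le_trans (normr_ge0 _) (kernel_gap_le tm D_z1 Dv Dw).
rewrite [leRHS]mulrAC [N * _]mulrC ler_wpM2l ?mulr_ge0//; lra.
Qed.

Definition contraction_factor v : R :=
  \sum_(1 <= t < m.+1) M t * L * (theta t v - theta t.-1 v).

Lemma contraction_factor_le v : D v ->
  contraction_factor v <= sup [set contraction_factor v | v in D].
Proof.
move=> Dv; apply: ub_le_sup; last by exists v.
exists (\sum_(1 <= t < m.+1) M t * L * (z2 - z1)) => _ [w Dw <-].
rewrite /contraction_factor !big_seq; apply: ler_sum => t.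
rewrite mem_index_iota ltnS => tm; have /andP[t1 t2] := tm.
have t2' := leq_trans (leq_pred t) t2.
have [/andP[a1 a2] /andP[b1 b2]] := (theta_itv t2' Dw, theta_itv t2 Dw).
by rewrite ler_wpM2l ?mulr_ge0 ?kernel_max_ge0//; lra.
Qed.

Lemma contraction_factor_ge0 v : D v -> 0 <= contraction_factor v.
Proof.
move=> Dv; rewrite /contraction_factor big_seq; apply: sumr_ge0 => t.
rewrite mem_index_iota ltnS => tm.
by rewrite !mulr_ge0 ?kernel_max_ge0// subr_ge0; exact: theta_le.
Qed.

Lemma volterra_rhs_dist Z V v B : unif_continuous_on D Z ->
  unif_continuous_on D V -> D v ->
  (forall r, D r -> fuzzy_dist (Z r) (V r) <= B) ->
  fuzzy_dist (rhs Z v) (rhs V v) <= contraction_factor v * B.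
Proof.
move=> cZ cV Dv ZB; apply: le_trans (fuzzy_distD _ _ _ _) _.
rewrite fuzzy_distxx add0r; apply: le_trans (fuzzy_dist_sum _ _ _) _.
rewrite /contraction_factor mulr_suml !big_seq; apply: ler_sum => t.
rewrite mem_index_iota ltnS => tm; have /andP[t1 t2] := tm.
rewrite mulrAC; apply: FRint_dist; first exact: theta_le.
- exact: integrand_unif_continuous_cell.
- exact: integrand_unif_continuous_cell.
move=> r /andP[ar rb].
have /andP[a1 _] := theta_itv (leq_trans (leq_pred t) t2) Dv.
have /andP[_ b2] := theta_itv t2 Dv.
have Dr : D r by rewrite DP (le_trans a1)// (le_trans rb).
apply: le_trans (fuzzy_distZl _ _ (K_ge0 tm Dr Dv)) _; rewrite -mulrA.
apply: ler_pM; [exact: K_ge0|exact: fuzzy_dist_ge0| |].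
  exact: le_trans (ler_norm _) (kernel_le tm Dr Dv).
by apply: le_trans (G_lip _ _) _; rewrite ler_wpM2l// ZB.
Qed.

(** Adding [Y v] on both sides costs nothing, so the first increment of the
    iteration is just the norm of the integral term. *)
Lemma volterra_rhs_dist_forcing Z v N : unif_continuous_on D Z -> D v ->
  (forall r, D r -> fuzzy_norm (G (Z r)) <= N) ->
  L * fuzzy_dist (rhs Z v) (Y v) <= contraction_factor v * N.
Proof.
move=> cZ Dv ZN.
have -> : contraction_factor v * N =
    L * \sum_(1 <= t < m.+1) M t * N * (theta t v - theta t.-1 v).
  rewrite mulr_suml mulr_sumr; apply: eq_bigr => t _; ring.
rewrite ler_wpM2l//.
have Y0 : Y v = Y v + \sum_(1 <= t < m.+1) 0 by rewrite big1_eq addr0.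
rewrite [X in fuzzy_dist _ X]Y0; apply: le_trans (fuzzy_distD _ _ _ _) _.
rewrite fuzzy_distxx add0r.
apply: le_trans (fuzzy_dist_sum _ _ _) _; rewrite !big_seq; apply: ler_sum => t.
rewrite mem_index_iota ltnS => tm; have /andP[t1 t2] := tm.
apply: FRint_norm; first exact: theta_le.
  exact: integrand_unif_continuous_cell.
move=> r /andP[ar rb].
have /andP[a1 _] := theta_itv (leq_trans (leq_pred t) t2) Dv.
have /andP[_ b2] := theta_itv t2 Dv.
have Dr : D r by rewrite DP (le_trans a1)// (le_trans rb).
by apply: integrand_norm => //; exact: ZN.
Qed.

End volterra_operator.

(** * Picard iteration for fuzzy-valued functions *)

Section picard_iteration.
Context {R : realType} (D : set R).
Variable T : (R -> fuzzy_number R) -> R -> fuzzy_number R.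
Variables (u0 : R -> fuzzy_number R) (c C : R).
Implicit Types Z V : R -> fuzzy_number R.

Hypothesis compactD : compact D.
Hypothesis D_neq0 : D !=set0.
Hypothesis c_ge0 : 0 <= c.
Hypothesis c_lt1 : c < 1.
Hypothesis T_uc : forall Z, unif_continuous_on D Z -> unif_continuous_on D (T Z).
Hypothesis T_contraction : forall Z V B, unif_continuous_on D Z ->
  unif_continuous_on D V -> (forall r, D r -> fuzzy_dist (Z r) (V r) <= B) ->
  forall v, D v -> fuzzy_dist (T Z v) (T V v) <= c * B.
Hypothesis u0_uc : unif_continuous_on D u0.
Hypothesis u0_step : forall v, D v -> fuzzy_dist (u0 v) (T u0 v) <= C.

Let u n := iter n T u0.

(** The closed form of the sum of [C c ^ k] over [k >= n], where [C c ^ k] bounds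
    the k-th increment of [u]. *)
Definition geometric_tail n : R := C / (1 - c) * c ^+ n.

Let w := geometric_tail.

Let c1 : 0 < 1 - c. Proof. by rewrite subr_gt0. Qed.

Let w_tail n : w n = C * c ^+ n + w n.+1.
Proof. by rewrite /w /geometric_tail exprS; field; rewrite gt_eqF. Qed.

Let w_S n : w n.+1 = c * w n.
Proof. by rewrite /w /geometric_tail exprS; ring. Qed.

Lemma geometric_tail_cvg0 : geometric_tail @ \oo --> (0 : R).
Proof.
by apply: (@cvg_geometric _ (C / (1 - c)) c); rewrite ger0_norm.
Qed.

Let w_le e : 0 < e -> exists n, w n <= e.
Proof.
move=> e0; have /cvgrPdist_le/(_ _ e0)[n _ hn] := geometric_tail_cvg0.
exists n; have := hn n (leqnn n).
by rewrite sub0r normrN; exact: le_trans (ler_norm _).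
Qed.

Lemma picard_unif_continuous n : unif_continuous_on D (u n).
Proof. by elim: n => [//|n ih]; exact: T_uc. Qed.

Let u_step n v : D v -> fuzzy_dist (u n v) (u n.+1 v) <= C * c ^+ n.
Proof.
elim: n v => [|n ih] v Dv; first by rewrite mulr1 u0_step.
rewrite exprS mulrCA.
exact: (T_contraction (picard_unif_continuous n) (picard_unif_continuous n.+1) ih).
Qed.

Let C_ge0 : 0 <= C.
Proof.
by have [v Dv] := D_neq0; apply: le_trans (u0_step Dv); exact: fuzzy_dist_ge0.
Qed.

Let w_ge0 n : 0 <= w n.
Proof. by rewrite mulr_ge0 ?divr_ge0 ?exprn_ge0// ltW. Qed.

Let u_cauchy v m n : D v -> (m <= n)%N -> fuzzy_dist (u m v) (u n v) <= w m.
Proof.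
move=> Dv /subnKC <-; move: (n - m)%N => k.
elim: k m => [|k ih] m; first by rewrite addn0 fuzzy_distxx w_ge0.
rewrite addnS -addSn w_tail.
by apply: le_trans (fuzzy_dist_triangle (u m.+1 v) _ _) (lerD _ _);
  [exact: u_step|exact: ih].
Qed.

(** A uniform limit of uniformly continuous functions, hence in the domain of
    [T]; by contraction the limit of [u n.+1 = T (u n)] is the value of [T]. *)
Lemma picard_fixpoint : exists F, [/\ unif_continuous_on D F,
  forall v, D v -> F v = T F v &
  forall n v, D v -> fuzzy_dist (F v) (u n v) <= geometric_tail n].
Proof.
have /choice[F hF] : forall v, exists p, D v ->
    forall n, fuzzy_dist (u n v) p <= w n.
  move=> v; have [Dv|nDv] := pselect (D v); last by exists 0.
  have [p hp] := fuzzy_complete w_le (fun m n => @u_cauchy v m n Dv).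
  by exists p.
have cF : unif_continuous_on D F.
  move=> e e0; have e30 : 0 < e / 3 by rewrite divr_gt0.
  have [n wn] := w_le e30; have [d d0 hd] := picard_unif_continuous n e30.
  exists d => // x y Dx Dy xy; rewrite /ball /=.
  have ux := le_trans (hF _ Dx n) wn; have uy := le_trans (hF _ Dy n) wn.
  have uxy : fuzzy_dist (u n x) (u n y) < e / 3 by exact: hd xy.
  apply: le_lt_trans (fuzzy_dist_triangle (u n x) _ _) _.
  have := fuzzy_dist_triangle (u n y) (u n x) (F y).
  by rewrite (fuzzy_dist_sym (F x)); move: ux uy uxy; lra.
exists F; split=> // [v Dv|n v Dv]; last by rewrite fuzzy_dist_sym; exact: hF.
apply: fuzzy_dist_eq0; apply/le_anti; rewrite fuzzy_dist_ge0 andbT.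
apply/ler_addgt0Pl => e e0; rewrite addr0.
have e20 : 0 < e / 2 by rewrite divr_gt0.
have [n wn] := w_le e20.
apply: le_trans (fuzzy_dist_triangle (u n.+1 v) _ _) _.
have FS := hF v Dv n.+1; rewrite fuzzy_dist_sym in FS.
have TF : fuzzy_dist (u n.+1 v) (T F v) <= c * w n.
  by apply: T_contraction => // [|r Dr]; [exact: picard_unif_continuous|exact: hF].
have : w n.+1 <= w n by rewrite w_S ler_piMl// ltW.
by move: FS TF; rewrite w_S; lra.
Qed.

(** The supremum S of the distance of two fixed points, finite by compactness,
    satisfies S <= c S. *)
Lemma contraction_fixpoint_unique Z V :
  unif_continuous_on D Z -> unif_continuous_on D V ->
  (forall v, D v -> Z v = T Z v) -> (forall v, D v -> V v = T V v) ->
  forall v, D v -> Z v = V v.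
Proof.
move=> cZ cV fZ fV.
pose A := [set fuzzy_dist (Z v) (V v) | v in D].
have cZV : unif_continuous_on D (fun v => fuzzy_dist (Z v) (V v)).
  apply: (unif_small_le (unif_smallD cZ cV)) => x y _ _.
  have := fuzzy_dist_triangle (Z x) (Z y) (V y).
  have := fuzzy_dist_triangle (V x) (Z x) (V y).
  have := fuzzy_dist_triangle (Z y) (Z x) (V x).
  have := fuzzy_dist_triangle (V y) (Z y) (V x).
  rewrite (fuzzy_dist_sym (Z y) (Z x)) (fuzzy_dist_sym (V y) (V x)).
  by rewrite ler_norml /=; lra.
have A_le v : D v -> fuzzy_dist (Z v) (V v) <= sup A.
  move=> Dv; apply: ub_le_sup; last by exists v.
  have [B _ hB] := unif_continuous_bounded compactD cZV.
  by exists B => _ [x Dx <-]; apply: le_trans (ler_norm _) (hB _ Dx).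
have A0 : sup A <= c * sup A.
  apply: ge_sup; first by have [v Dv] := D_neq0; exists (fuzzy_dist (Z v) (V v)), v.
  by move=> _ [v Dv <-]; rewrite fZ// fV//; exact: T_contraction.
move=> v Dv; apply: fuzzy_dist_eq0; apply/le_anti; rewrite fuzzy_dist_ge0 andbT.
apply: le_trans (A_le _ Dv) _; move: c1 A0; nra.
Qed.

End picard_iteration.

(** * The fuzzy Volterra integral equation *)

Theorem theorem5 (R : realType) (z1 z2 : R) (hz : z1 < z2)
  (m' : nat) (hm' : (1 <= m')%N)
  (theta : nat -> R -> R)
  (theta_continuous : forall t, (t <= m')%N ->
    {within `[z1, z2], continuous (theta t)})
  (theta_range : forall t, (t <= m')%N ->
    forall v, z1 <= v <= z2 -> z1 <= theta t v <= z2)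
  (theta_z1 : forall t, (t <= m')%N -> theta t z1 = z1)
  (theta_first : forall v, z1 < v <= z2 -> theta 0%N v = z1)
  (theta_lt : forall v, z1 < v <= z2 ->
    forall t, (t < m')%N -> theta t v < theta t.+1 v)
  (theta_last : forall v, z1 < v <= z2 -> theta m' v = v)
  (K : nat -> R -> R -> R)
  (K_continuous : forall t, (1 <= t <= m')%N ->
    {within `[z1, z2] `*` `[z1, z2],
      continuous (fun rv : R * R => K t rv.1 rv.2)})
  (K_pos : forall t, (1 <= t <= m')%N ->
    forall r v, z1 <= r <= z2 -> z1 <= v <= z2 -> 0 < K t r v)
  (Y : R -> fuzzy_number R) (Y_continuous : fuzzy_continuous z1 z2 Y)
  (G : fuzzy_number R -> fuzzy_number R) (G_continuous : continuous G)
  (L : R) (L_gt0 : 0 < L)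
  (G_lipschitz : forall p p1, z1 <= p <= z2 -> z1 <= p1 <= z2 ->
    forall Z1 Z2, fuzzy_continuous z1 z2 Z1 -> fuzzy_continuous z1 z2 Z2 ->
      fuzzy_dist (G (Z1 p)) (G (Z2 p1)) <= L * fuzzy_dist (Z1 p) (Z2 p1))
  (c : R)
  (c_def : c = sup [set \sum_(1 <= t < m'.+1)
      kernel_max z1 z2 (K t) * L * (theta t v - theta t.-1 v) | v in `[z1, z2]])
  (c_lt1 : c < 1)
  (M0 : R)
  (M0_def : M0 = sup [set fuzzy_norm (G (Y v)) | v in `[z1, z2]]) :
  let solution := volterra_solution z1 z2 m' theta K G Y in
  let Zapprox := successive_approximation m' theta K G Y in
  exists F : R -> fuzzy_number R,
    [/\ fuzzy_continuous z1 z2 F /\ solution F,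
        forall V, fuzzy_continuous z1 z2 V -> solution V ->
          forall v, z1 <= v <= z2 -> V v = F v,
        forall m, fuzzy_continuous z1 z2 (Zapprox m) /\
          volterra_integrable z1 z2 m' theta K G (Zapprox m),
        (fun m => fuzzy_unif_dist z1 z2 F (Zapprox m)) @ \oo --> (0 : R) &
        forall m, (1 <= m)%N -> forall v, z1 <= v <= z2 ->
          fuzzy_dist (F v) (Zapprox m v) <= c ^+ m.+1 / (L * (1 - c)) * M0].
Proof.
move=> solution Zapprox.
pose D : set R := `[z1, z2]%classic.
have z12 := ltW hz.
have DP v : D v = (z1 <= v <= z2) :> Prop by rewrite /D /= in_itv.
have compactD : compact D by exact: segment_compact.
have D_z1 : D z1 by rewrite DP lexx.
have fcP Z : fuzzy_continuous z1 z2 Z <-> unif_continuous_on D Z.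
  by split; [exact: compact_unif_continuous|exact: unif_continuous_within].
(* every fuzzy number is a value of some element of X, namely a constant one *)
have G_lip p q : fuzzy_dist (G p) (G q) <= L * fuzzy_dist p q.
  have cst (r : fuzzy_number R) : fuzzy_continuous z1 z2 (fun=> r).
    by apply/fcP => e e0; exists 1 => // x y _ _ _; exact: ballxx.
  have h1 : z1 <= z1 <= z2 by rewrite lexx.
  exact: (G_lipschitz _ _ h1 h1 _ _ (cst p) (cst q)).
have theta_uc t : (t <= m')%N -> unif_continuous_on D (theta t).
  by move=> /theta_continuous; exact: compact_unif_continuous.
have theta_itv t : (t <= m')%N -> forall v, D v -> z1 <= theta t v <= z2.
  by move=> tm v; rewrite DP; exact: theta_range.
(* at z1 all the theta collapse, so the order is only weak there *)
have theta_le t : (1 <= t <= m')%N -> forall v, D v -> theta t.-1 v <= theta t v.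
  case: t => // t /= tm v; rewrite DP => /andP[]; rewrite le_eqVlt.
  move=> /predU1P[<- _|v1 v2]; first by rewrite !theta_z1// ltnW.
  by apply/ltW/theta_lt => //; rewrite v1.
have K_uc t : (1 <= t <= m')%N ->
    unif_continuous_on (D `*` D) (fun rv : R * R => K t rv.1 rv.2).
  move=> /K_continuous; apply: compact_unif_continuous; exact: compact_setX.
have K_ge0 t : (1 <= t <= m')%N -> forall r v, D r -> D v -> 0 <= K t r v.
  by move=> tm r v; rewrite !DP => rD vD; apply/ltW/K_pos.
have L_ge0 := ltW L_gt0.
have Y_uc : unif_continuous_on D Y by apply/fcP.
pose T := volterra_rhs m' theta K G Y.
have factor_le v : D v -> contraction_factor z1 z2 m' theta K L v <= c.
  by move=> Dv; rewrite c_def; exact: contraction_factor_le.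
have c_ge0 : 0 <= c.
  by apply: le_trans (factor_le _ D_z1); exact: contraction_factor_ge0.
have T_uc Z : unif_continuous_on D Z -> unif_continuous_on D (T Z).
  by move=> cZ; exact: (volterra_rhs_unif_continuous (L := L)).
have T_contraction Z V B : unif_continuous_on D Z -> unif_continuous_on D V ->
    (forall r, D r -> fuzzy_dist (Z r) (V r) <= B) ->
    forall v, D v -> fuzzy_dist (T Z v) (T V v) <= c * B.
  move=> cZ cV ZVB v Dv.
  have B0 : 0 <= B := le_trans (fuzzy_dist_ge0 _ _) (ZVB _ D_z1).
  apply: (@le_trans _ _ (contraction_factor z1 z2 m' theta K L v * B)).
    exact: volterra_rhs_dist.
  by rewrite ler_wpM2r// factor_le.
have GY_le r : D r -> fuzzy_norm (G (Y r)) <= M0.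
  move=> Dr; have [N _ hN] := G_norm_bounded L_ge0 G_lip Y_uc.
  by rewrite M0_def; apply: ub_le_sup; [exists N => _ [v Dv <-]; exact: hN|exists r].
have M0_ge0 : 0 <= M0 := le_trans (fuzzy_dist_ge0 _ _) (GY_le _ D_z1).
have Y_step v : D v -> fuzzy_dist (Y v) (T Y v) <= c * M0 / L.
  move=> Dv; rewrite ler_pdivlMr// mulrC fuzzy_dist_sym.
  apply: (@le_trans _ _ (contraction_factor z1 z2 m' theta K L v * M0)).
    exact: volterra_rhs_dist_forcing.
  by rewrite ler_wpM2r// factor_le.
have D_neq0 : D !=set0 by exists z1.
have ZapproxE n : Zapprox n = iter n T Y.
  by elim: n => //= n ih; rewrite -ih.
have integrable Z : unif_continuous_on D Z -> volterra_integrable z1 z2 m' theta K G Z.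
  exact: (volterra_integrable_unif_continuous (L := L)).
have [F [cF TF FZ]] :=
  picard_fixpoint D_neq0 c_ge0 c_lt1 T_uc T_contraction Y_uc Y_step.
have Zapprox_uc n : unif_continuous_on D (Zapprox n).
  by rewrite ZapproxE; exact: picard_unif_continuous.
exists F; split.
- split; first exact/fcP.
  by split=> [|v]; [exact: integrable|rewrite -DP; exact: TF].
- move=> V /fcP cV [_ TV] v; rewrite -DP => Dv.
  have TV' x : D x -> V x = T V x by rewrite DP; exact: TV.
  exact: (contraction_fixpoint_unique compactD D_neq0 c_lt1 T_contraction cV cF TV' TF).
- by move=> n; split; [exact/fcP|exact: integrable].
- apply: (squeeze_cvgr (f := fun=> 0) (h := geometric_tail c (c * M0 / L))).
  + apply: nearW => n; apply/andP; split; last first.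
      apply: ge_sup; first by exists (fuzzy_dist (F z1) (Zapprox n z1)), z1.
      by move=> _ [v Dv <-]; rewrite ZapproxE; exact: FZ.
    apply: le_trans (fuzzy_dist_ge0 (F z1) (Zapprox n z1)) _.
    apply: ub_le_sup; last by exists z1.
    exists (geometric_tail c (c * M0 / L) n) => _ [v Dv <-].
    by rewrite ZapproxE; exact: FZ.
  + exact: cvg_cst.
  + exact: geometric_tail_cvg0.
- move=> n _ v; rewrite -DP => /(FZ n); rewrite -ZapproxE.
  congr (_ <= _); rewrite /geometric_tail exprS; field.
  by rewrite !gt_eqF// subr_gt0.
Qed.
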